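(* Let $d\ge1$ and let $p$ be a Borel measurable transition density on $X=\mathbb{R}^d$ with the Lebesgue measure $dz$. Assume that $b>0$, $\Lambda\ge1$ and $\lambda\in\mathbb{R}$ exist such that for $s<t$, $$p(s,x,t,y)\le\Lambda e^{\lambda(t-s)}g_b(s,x,t,y),\qquad x,y\in\mathbb{R}^d.$$ Let $0<a<b$ and $C=\Lambda(b/a)^{d/2}$. If $q\in\mathcal{N}(g_b,g_a,(b/a)^{d/2},\eta,Q)$, then for all $s<t$, $x,y\in\mathbb{R}^d$ and $0<\varepsilon<1-\Lambda\eta$, $$\tilde p(s,x,t,y)\le\left(\frac{C}{1-\Lambda\eta-\varepsilon}\right)^{1+\frac{\Lambda Q(s,t)}{\varepsilon}}e^{\lambda(t-s)}g_a(s,x,t,y),$$ where $\tilde p$ is the Schrödinger perturbation of $p$ by $q$. Further, if $d\ge3$, $h>0$, $q\ge 0$ is time-independent (i.e. $q(u,z)=q(z)$) and $I_{\sqrt h}(q)<\infty$, then $q\in\mathcal{N}(g_b,g_a,(b/a)^{d/2},\eta,Q)$ with $$\eta=b\,c_0\,M\,I_{\sqrt h}(q),\qquad Q(s,t)=(t-s)\,I_{\sqrt h}(q)\,\frac{2M}{|B(0,1/2)|\,h}\quad (s<t).$$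
   Context: For $a>0$, $s<t$, $x,y\in\mathbb{R}^d$: $g_a(s,x,t,y)=[4\pi(t-s)/a]^{-d/2}\exp\{-|y-x|^2/[4(t-s)/a]\}$, and $g_a(s,x,t,y)=0$ if $s\ge t$. A (Borel) measurable transition density on $X=\mathbb{R}^d$ is a Borel function $p\colon\mathbb{R}\times\mathbb{R}^d\times\mathbb{R}\times\mathbb{R}^d\to[0,\infty]$ with $\int_{\mathbb{R}^d}p(s,x,u,z)p(u,z,t,y)\,dz=p(s,x,t,y)$ for all $x,y\in\mathbb{R}^d$, $s<u<t$. For Borel $q\colon\mathbb{R}\times\mathbb{R}^d\to[0,\infty]$ the Schrödinger perturbation of $p$ by $q$ is $\tilde p=\sum_{n=0}^\infty p_n$, where $p_0=p$ and $p_n(s,x,t,y)=\int_s^t\int_{\mathbb{R}^d}p(s,x,u,z)q(u,z)p_{n-1}(u,z,t,y)\,dz\,du$, $n\ge1$, $s<t$. $Q\colon\mathbb{R}\times\mathbb{R}\to[0,\infty)$ is regular superadditive if $Q(s,u)+Q(u,t)\le Q(s,t)$ for $s<u<t$, $Q(s,t)=0$ if $s\ge t$, $s\mapsto Q(s,t)$ is right-continuous and $t\mapsto Q(s,t)$ is left-continuous. For transition densities $r,r^*$, a constant $K\ge1$, $\eta\ge0$ and regular superadditive $Q$, $q\in\mathcal{N}(r,r^*,K,\eta,Q)$ means that $q\ge0$ is measurable on space-time and for all $s<t$, $x,y\in\mathbb{R}^d$: $r(s,x,t,y)\le K\,r^*(s,x,t,y)$ and $\int_s^t\int_{\mathbb{R}^d}r(s,x,u,z)q(u,z)r^*(u,z,t,y)\,dz\,du\le[\eta+Q(s,t)]\,r^*(s,x,t,y)$.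 For $d\ge3$: $I_\delta(U)=\sup_{x\in\mathbb{R}^d}\int_{|z-x|<\delta}\frac{|U(z)|}{|z-x|^{d-2}}\,dz$ for $\delta>0$, and $c_0=c_0(d)=\Gamma(d/2-1)\pi^{-d/2}/4$. $|B(0,1/2)|$ is the volume of the ball of radius $1/2$ in $\mathbb{R}^d$. $M=\left(\frac{b}{b-a}\right)^{d/2}\exp\left[\frac d2L\left(\frac{a}{b-a}\right)\right]$, where for $\alpha>0$, $L(\alpha)=\max_{\tau\ge\alpha\vee1/\alpha}\left[\ln(1+\tau)-\frac{\tau-\alpha}{1+\tau}\ln(\alpha\tau)\right]$ and $\alpha\vee\beta=\max\{\alpha,\beta\}$. *)

(* Defs.v *)
From HB Require Import structures.
From mathcomp Require Import all_boot all_order all_algebra.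
From mathcomp Require Import all_classical all_reals all_analysis.
From mathcomp Require Import measurable_realfun.
Import Order.TTheory GRing.Theory Num.Theory.
Import numFieldNormedType.Exports.

Set Implicit Arguments.
Unset Strict Implicit.
Unset Printing Implicit Defensive.

Local Open Scope classical_set_scope.
Local Open Scope ring_scope.

Lemma product_sigma_finite d1 d2 (T1 : measurableType d1)
    (T2 : measurableType d2) (R : realType)
    (m1 : {sigma_finite_measure set T1 -> \bar R})
    (m2 : {sigma_finite_measure set T2 -> \bar R}) :
  sigma_finite setT (m1 \x m2)%E.
Proof.
have /sigma_finiteP[F [TF ndF Foo]] := sigma_finiteT m1.
have /sigma_finiteP[G [TG ndG Goo]] := sigma_finiteT m2.
exists (fun n => F n `*` G n).
  rewrite -setXTT TF TG predeqE => -[x y]; split.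
    move=> [/= [n _ Fnx] [k _ Gky]]; exists (maxn n k) => //; split.
    - by move: x Fnx; exact/subsetPset/ndF/leq_maxl.
    - by move: y Gky; exact/subsetPset/ndG/leq_maxr.
  by move=> [n _ []/= ? ?]; split; exists n.
move=> k; have [? ?] := Foo k; have [? ?] := Goo k.
split; first exact: measurableX.
by rewrite product_measure1E// lte_mul_pinfty// ge0_fin_numE.
Qed.

(* R^d is [d.-tuple R]: the library's product sigma-algebra on it is the Borel
   sigma-algebra.  Lebesgue measure on R^d is the d-fold product of the
   one-dimensional one, transported along (x, v) |-> x :: v. *)
Section lebesgue_tuple.
Variable R : realType.
Local Open Scope ereal_scope.

Section cons.
Variables (n : nat) (m : {sigma_finite_measure set (n.-tuple R) -> \bar R}).

Definition consT (w : R * n.-tuple R) : n.+1.-tuple R := [tuple of w.1 :: w.2].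

Lemma measurable_consT : measurable_fun [set: R * n.-tuple R] consT.
Proof. exact: measurable_cons measurable_fst measurable_snd. Qed.

Definition lebesgue_cons : set (n.+1.-tuple R) -> \bar R :=
  pushforward (@lebesgue_measure R \x m) consT.

Let lebesgue_cons0 : lebesgue_cons set0 = 0.
Proof. by rewrite /lebesgue_cons /pushforward preimage_set0 measure0. Qed.

Let lebesgue_cons_ge0 A : 0 <= lebesgue_cons A.
Proof. by rewrite /lebesgue_cons /pushforward; exact: measure_ge0. Qed.

Let lebesgue_cons_sigma_additive : semi_sigma_additive lebesgue_cons.
Proof.
move=> F mF tF mUF; rewrite /lebesgue_cons /pushforward preimage_bigcup.
apply: measure_semi_sigma_additive.
- by move=> k; rewrite -[X in measurable X]setTI; exact: measurable_consT.
- apply/trivIsetP => /= i j _ _ ij; rewrite -preimage_setI.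
  by move/trivIsetP : tF => /(_ _ _ _ _ ij) ->//; rewrite preimage_set0.
- by rewrite -preimage_bigcup -[X in measurable X]setTI;
    exact: measurable_consT.
Qed.

HB.instance Definition _ := isMeasure.Build _ _ _
  lebesgue_cons lebesgue_cons0 lebesgue_cons_ge0 lebesgue_cons_sigma_additive.

Let lebesgue_cons_sigma_finite : sigma_finite setT lebesgue_cons.
Proof.
have [F FT mF] : sigma_finite setT (@lebesgue_measure R \x m).
  exact: product_sigma_finite.
pose unconsT (t : n.+1.-tuple R) : R * n.-tuple R :=
  (tnth t ord0, [tuple of behead t]).
have munconsT : measurable_fun [set: n.+1.-tuple R] unconsT.
  by apply: measurable_fun_pair; [exact: measurable_tnth|exact: measurable_behead].
have consTK w : unconsT (consT w) = w.
  by case: w => x v; congr pair; apply: val_inj.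
exists (fun k => unconsT @^-1` F k).
  by rewrite -preimage_bigcup -FT preimage_setT.
move=> k; have [mFk Fk] := mF k; split.
  by rewrite -[X in measurable X]setTI; exact: munconsT.
rewrite /lebesgue_cons /pushforward (_ : consT @^-1` _ = F k)//.
by apply/seteqP; split => w /=; rewrite consTK.
Qed.

HB.instance Definition _ := @Measure_isSigmaFinite.Build _ _ _
  lebesgue_cons lebesgue_cons_sigma_finite.

End cons.

Fixpoint lebesgue_tuple (n : nat) :
    {sigma_finite_measure set (n.-tuple R) -> \bar R} :=
  match n with
  | 0 => dirac [tuple]
  | n'.+1 => lebesgue_cons (lebesgue_tuple n')
  end.

Lemma lebesgue_tuple_box n (A : 'I_n -> set R) :
  (forall i, measurable (A i)) ->
  lebesgue_tuple n [set t | forall i, A i (tnth t i)] =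
  \prod_(i < n) lebesgue_measure (A i).
Proof.
elim: n A => [|n IHn] A mA.
  rewrite big_ord0 /= diracE (_ : _ \in _)//.
  by rewrite inE /= => -[].
rewrite big_ord_recl -IHn//= /lebesgue_cons /pushforward.
have mB : measurable
    [set t : n.-tuple R | forall i, A (lift ord0 i) (tnth t i)].
  have -> : [set t : n.-tuple R | forall i, A (lift ord0 i) (tnth t i)] =
      \bigcap_(i in [set: 'I_n]) ((@tnth _ _ ^~ i) @^-1` A (lift ord0 i)).
    by apply/seteqP; split=> [t h i _|t h i]; exact: h.
  apply: fin_bigcap_measurable => // i _.
  by rewrite -[X in measurable X]setTI; exact: measurable_tnth.
rewrite -product_measure1E//; last exact: (mA ord0).
rewrite [X in product_measure1 _ _ X = _](_ : _ = A ord0 `*`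
    [set t | forall i, A (lift ord0 i) (tnth t i)])//.
apply/seteqP; split=> -[x v] /=.
  move=> h; split; first by have := h ord0.
  by move=> i; have := h (lift ord0 i); rewrite tnthS.
move=> [h0 hS] i; case: (unliftP ord0 i) => [j ->|->//].
by rewrite tnthS; exact: hS.
Qed.

End lebesgue_tuple.

Section kernels.
Variables (R : realType) (d : nat).
Local Notation X := (d.-tuple R).
Local Notation leb := (@lebesgue_measure R).
Local Notation lebd := (lebesgue_tuple R d).

Definition edist (x y : X) : R :=
  Num.sqrt (\sum_(i < d) (tnth x i - tnth y i) ^+ 2).

Definition kernel_fun := R -> X -> R -> X -> \bar R.

Record transition_density (p : kernel_fun) : Prop := TransitionDensity {
  transition_ge0 : forall s x t y, (0 <= p s x t y)%E ;
  transition_measurable : measurable_fun [set: (R * X) * (R * X)]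
    (fun w : (R * X) * (R * X) => p w.1.1 w.1.2 w.2.1 w.2.2) ;
  transition_CK : forall s u t x y, s < u -> u < t ->
    (\int[lebd]_z (p s x u z * p u z t y) = p s x t y)%E }.

Definition gauss (a : R) : kernel_fun := fun s x t y =>
  (if s < t then
     (4 * pi * (t - s) / a) `^ (- (d%:R / 2)) *
     expR (- (edist y x ^+ 2 / (4 * (t - s) / a)))
   else 0)%:E.

(* Only the values for s < t matter: the recursion calls itself at (u, t) with
   u in ]s, t[. *)
Fixpoint perturbation_term (p : kernel_fun) (q : R -> X -> \bar R) (n : nat) :
    kernel_fun :=
  match n with
  | 0 => p
  | n'.+1 => fun s x t y =>
      (\int[leb]_(u in `]s, t[) \int[lebd]_z
         (p s x u z * q u z * perturbation_term p q n' u z t y))%E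
  end.

Definition schrodinger_perturbation (p : kernel_fun) (q : R -> X -> \bar R) :
    kernel_fun :=
  fun s x t y => (\sum_(0 <= n <oo) perturbation_term p q n s x t y)%E.

Record regular_superadditive (Q : R -> R -> R) : Prop := RegularSuperadditive {
  superadditive_ge0 : forall s t, 0 <= Q s t ;
  superadditiveD : forall s u t, s < u -> u < t -> Q s u + Q u t <= Q s t ;
  superadditive0 : forall s t, t <= s -> Q s t = 0 ;
  superadditive_rcont : forall s t, Q u t @[u --> s^'+] --> Q s t ;
  superadditive_lcont : forall s t, Q s u @[u --> t^'-] --> Q s t }.

Record class_N (r rs : kernel_fun) (K eta : R) (Q : R -> R -> R)
    (q : R -> X -> \bar R) : Prop := ClassN {
  class_N_r : transition_density r ;
  class_N_rs : transition_density rs ;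
  class_N_K : 1 <= K ;
  class_N_eta : 0 <= eta ;
  class_N_Q : regular_superadditive Q ;
  class_N_q_ge0 : forall u z, (0 <= q u z)%E ;
  class_N_q_measurable :
    measurable_fun [set: R * X] (fun w : R * X => q w.1 w.2) ;
  class_N_le : forall s t x y, s < t ->
    (r s x t y <= K%:E * rs s x t y)%E ;
  class_N_int_le : forall s t x y, s < t ->
    (\int[leb]_(u in `]s, t[) \int[lebd]_z (r s x u z * q u z * rs u z t y)
     <= (eta + Q s t)%:E * rs s x t y)%E }.

(* The integrand at z = x is irrelevant, [set x] being a null set. *)
Definition kato (delta : R) (U : X -> \bar R) : \bar R :=
  ereal_sup (range (fun x : X =>
    \int[lebd]_(z in [set z | edist z x < delta]%R)
      (`|U z| * (edist z x ^- (d - 2))%:E)))%E.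

Definition ball_volume (rho : R) : R :=
  fine (lebd [set z | edist z [tuple of nseq d 0] < rho]).

Definition Gamma (x : R) : R :=
  fine (\int[leb]_(t in `]0%R, +oo[) (t `^ (x - 1) * expR (- t))%:E)%E.

Definition c0 : R := Gamma (d%:R / 2 - 1) * pi `^ (- (d%:R / 2)) / 4.

(* The supremum is a maximum: the function is continuous on
   [max(alpha, 1/alpha), +oo[ and tends at +oo to - ln alpha, which is less
   than its value at the left endpoint. *)
Definition L_const (alpha : R) : R :=
  sup [set ln (1 + tau) - (tau - alpha) / (1 + tau) * ln (alpha * tau)
      | tau in [set tau | Num.max alpha alpha^-1 <= tau]].

Definition M_const (a b : R) : R :=
  (b / (b - a)) `^ (d%:R / 2) * expR (d%:R / 2 * L_const (a / (b - a))).

End kernels.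
Arguments gauss {R d}.
Arguments c0 {R}.
Arguments M_const {R}.
Arguments ball_volume {R}.

(* Main.v *)
Require Import Defs.
From mathcomp Require Import all_boot all_order all_algebra.
From mathcomp Require Import all_classical all_reals all_analysis.
From mathcomp Require Import measurable_realfun.
From mathcomp Require Import ring lra.
Import Order.TTheory GRing.Theory Num.Theory.
Import numFieldNormedType.Exports.

(** The theorem has two independent halves.

    Upper bound for the perturbation series.  With
    r = exp (lam (t - s)) g_a as majorant, the hypotheses read p <= C r and
    T r <= (eta' + Q') r, where
    T k (s,x,t,y) = int_s^t int p(s,x,u,z) q(u,z) k(u,z,t,y) dz du,
    eta' = Lam eta and Q' = Lam Q.  The partial sums of the series are the
    Picard iterates S_0 = 0, S_(n+1) = p + T S_n.  As long as Q'(s,t) <= eps,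
    the number B = C / (1 - eta' - eps) satisfies C + (eta' + eps) B = B, so
    S_n <= B r by induction on n ([picard_le_short]).  On a longer time
    interval the Picard iterates are sub-multiplicative in time:
    S_n(s,x,t,y) <= int S_n(s,x,u,z) S_n(u,z,t,y) dz ([picard_subCK]): a chain
    of interactions with q that takes place in ]s,t[ splits at time u into a
    chain before u and a chain after u, each of them no longer than the whole.
    Regularity of Q' lets one cut off a piece of [s,t] on which Q' is at most
    eps while Q' drops by at least eps on the rest ([superadditive_cut]).
    Hence at most 1 + Q'(s,t) / eps pieces are needed, each of them costs a
    factor B >= 1, and the Chapman-Kolmogorov equation of r glues the pieces.

    Membership of a Kato-type q in the class N.  The exact constant M comes
    from the pointwise bound
    g_b(s,x,u,z) g_a(u,z,t,y) <= M (g_(b-a)(s,x,u,z) + g_a(u,z,t,y)) g_a(s,x,t,y)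
    ([gauss_mul_le]).  Writing g_b as a multiple of g_(b-a) times a Gaussian
    factor, the product of g_(b-a) and g_a is at most their sum times their
    minimum; the minimum is estimated by a weighted geometric mean, and the
    weights for which the remaining quadratic form in z is nonnegative lead to
    the function maximised in L.  It remains to bound the potential
    int_0^T int g_c(0,x,v,z) q(z) dz dv by
    c c0 I + T I / (|B(0,1/2)| h) for c = b - a and for c = a
    ([potential_le]); the values c0 (b - a) and c0 a add up to c0 b.  Near x,
    integration in time first produces the Newtonian kernel with its Gamma
    constant ([integral_gauss_time]).  Far from x, the Gaussian at z is at most
    its average over a ball of radius sqrt h / 2 that lies on the side of x,
    and q has mass at most h^((d-2)/2) I on each ball of radius sqrt h
    ([potential_far]).  *)

Set Implicit Arguments.
Unset Strict Implicit.
Unset Printing Implicit Defensive.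

Local Open Scope classical_set_scope.
Local Open Scope ring_scope.

(* The Euclidean distance on tuples, as opposed to the extended distance of
   metric spaces that has the same short name. *)
Local Notation edist := (@Defs.edist _ _).

(** * Integrals of nonnegative functions and superadditive functions *)

Section integral_tools.
Local Open Scope ereal_scope.
Context d1 d2 (T1 : measurableType d1) (T2 : measurableType d2) (R : realType).

(** The integral of a nonnegative function is a supremum over
    simple minorants, so that monotonicity holds without measurability; this
    keeps the measurability obligations of the estimates below to a minimum. *)
Lemma ge0_integral_mono (mu : {measure set T1 -> \bar R}) (D : set T1)
    (f g : T1 -> \bar R) :
  (forall x, D x -> 0 <= f x) -> (forall x, D x -> f x <= g x) ->
  \int[mu]_(x in D) f x <= \int[mu]_(x in D) g x.
Proof.
move=> f0 fg; rewrite !ge0_integralE//; last first.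
  by move=> x Dx; apply: le_trans (fg x Dx); exact: f0.
apply: ge_ereal_sup => _ [h hf <-]; apply: ereal_sup_ubound; exists h => // x.
by apply: le_trans (hf x) _; apply: lee_restrict.
Qed.

Lemma ge0_integralZD (mu : {measure set T1 -> \bar R}) (D : set T1) (c : \bar R)
    (f g : T1 -> \bar R) :
  measurable D -> 0 <= c ->
  measurable_fun setT f -> measurable_fun setT g ->
  (forall x, 0 <= f x) -> (forall x, 0 <= g x) ->
  \int[mu]_(x in D) (c * (f x + g x)) =
  c * (\int[mu]_(x in D) f x + \int[mu]_(x in D) g x).
Proof.
move=> mD c0 mf mg f0 g0.
have mfD : measurable_fun D f by exact: measurable_funTS.
have mgD : measurable_fun D g by exact: measurable_funTS.
rewrite ge0_integralZl//; last 2 first.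
- exact: emeasurable_funD.
- by move=> x _; exact: adde_ge0.
by rewrite ge0_integralD.
Qed.

Lemma measurable_integral2 (m2 : {sigma_finite_measure set T2 -> \bar R})
    (f : T1 -> T2 -> \bar R) :
  measurable_fun [set: T1 * T2] (fun w => f w.1 w.2) ->
  (forall x y, 0 <= f x y) ->
  measurable_fun [set: T1] (fun x => \int[m2]_y f x y).
Proof.
move=> mf f0.
exact: (@measurable_fun_fubini_tonelli_F _ _ _ _ _ m2 (fun w => f w.1 w.2)).
Qed.

(** Tonelli's theorem with the first variable confined to [D], which
    is the form in which time integrals over ]s,t[ are exchanged with space
    integrals. *)
Lemma tonelli_in (m1 : {sigma_finite_measure set T1 -> \bar R})
    (m2 : {sigma_finite_measure set T2 -> \bar R}) (D : set T1)
    (f : T1 -> T2 -> \bar R) :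
  measurable D ->
  measurable_fun [set: T1 * T2] (fun w => f w.1 w.2) ->
  (forall x y, 0 <= f x y) ->
  \int[m1]_(x in D) \int[m2]_y f x y = \int[m2]_y \int[m1]_(x in D) f x y.
Proof.
move=> mD mf f0.
pose g (w : T1 * T2) := if w.1 \in D then f w.1 w.2 else 0.
have mg : measurable_fun setT g.
  apply: measurable_fun_ifT => //.
  apply: (@measurableT_comp _ _ _ _ _ _ (fun x : T1 => x \in D)) => //.
  apply: (measurable_fun_bool true); rewrite setTI.
  rewrite (_ : _ @^-1` _ = D)//; apply/seteqP; split=> x /=.
    exact: set_mem.
  exact: mem_set.
have g0 w : 0 <= g w by rewrite /g; case: ifP.
transitivity (\int[m1]_x \int[m2]_y g (x, y)).
  rewrite integral_mkcond; apply: eq_integral => x _; rewrite /patch /g/=.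
  by case: ifP => // _; rewrite integral0.
transitivity (\int[m2]_y \int[m1]_x g (x, y)).
  exact: (fubini_tonelli (m1 := m1) (m2 := m2) g mg g0).
apply: eq_integral => y _.
by rewrite [RHS]integral_mkcond; apply: eq_integral.
Qed.

End integral_tools.


Section superadditive.
Variables (R : realType) (Q : R -> R -> R).
Hypothesis Qsa : regular_superadditive Q.

(** The cut point is the supremum of the times [u] with
    Q(s,u) <= eps.  Left-continuity keeps Q(s,u) <= eps at the supremum; to its
    right Q(s,v) > eps, hence Q(v,t) <= Q(s,t) - eps by superadditivity, and
    right-continuity carries this over to the supremum.  The latter inequality
    also rules out u = s. *)
Lemma superadditive_cut (s t eps : R) : 0 < eps -> s < t -> eps < Q s t ->
  exists u, [/\ s < u, u < t, Q s u <= eps & Q u t <= Q s t - eps].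
Proof.
move=> eps0 st Qst.
pose E := [set u | s <= u <= t /\ Q s u <= eps].
have Es : E s.
  by split; [rewrite lexx ltW|rewrite (superadditive0 Qsa)// ltW].
have ubE : ubound E t by move=> u [/andP[]].
have supE : has_sup E by split; [exists s|exists t].
have su : s <= sup E by apply: ub_le_sup => //; exists t.
have ut : sup E <= t by apply: ge_sup => //; exists s.
set u := sup E in su ut.
have Qmono a b : s < a -> a < b -> Q s a <= Q s b.
  move=> sa ab; apply: le_trans (superadditiveD Qsa sa ab).
  by rewrite lerDl (superadditive_ge0 Qsa).
have Qsu : Q s u <= eps.
  have [->|us] := eqVneq u s; first by rewrite (superadditive0 Qsa)// ltW.
  have {}su : s < u by rewrite lt_neqAle eq_sym us.
  apply: (cvgr_to_le (@superadditive_lcont _ _ Qsa s u)); near=> v.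
  have sv : s < v by near: v; exact: nbhs_left_gt.
  have [w [_ Qw] vw] : exists2 w, E w & v < w.
    by apply: sup_gt; [exists s|near: v; exact: nbhs_left_lt].
  by apply: le_trans Qw; exact: Qmono.
have un : u < t.
  by rewrite lt_neqAle ut andbT; apply: contraTneq Qst => <-; rewrite -leNgt.
have Qut : Q u t <= Q s t - eps.
  apply: (cvgr_to_le (@superadditive_rcont _ _ Qsa u t)); near=> v.
  have uv : u < v by near: v; exact: nbhs_right_gt.
  have vt : v < t by near: v; exact: nbhs_right_lt.
  have sv : s < v by exact: le_lt_trans uv.
  rewrite lerBrDr addrC; apply: le_trans (superadditiveD Qsa sv vt).
  rewrite lerD2r leNgt; apply: contraTN uv => Qv.
  rewrite -leNgt; apply: ub_le_sup; first by exists t.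
  by split; [rewrite !ltW|exact: ltW].
exists u; split => //.
rewrite lt_neqAle su andbT; apply/eqP => E0.
by move: Qut; rewrite -E0 lerBrDr gerDl leNgt eps0.
Unshelve. all: by end_near. Qed.

End superadditive.

(** * The perturbation series *)

Section perturbation.
Variables (R : realType) (d : nat).
Local Notation X := (d.-tuple R).
Local Notation leb := (@lebesgue_measure R).
Local Notation lebd := (lebesgue_tuple R d).
Local Open Scope ereal_scope.

Definition kernel_measurable (p : kernel_fun R d) :=
  measurable_fun [set: (R * X) * (R * X)]
    (fun w : (R * X) * (R * X) => p w.1.1 w.1.2 w.2.1 w.2.2).

(** All kernels below are used with some of their four
    arguments fixed and the others shared; this lemma and the next one reduce
    the joint measurability of such expressions to that of projections. *)
Lemma measurable_kernel_comp (p : kernel_fun R d) dT (T : measurableType dT)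
    (s : T -> R) (x : T -> X) (t : T -> R) (y : T -> X) :
  kernel_measurable p ->
  measurable_fun setT s -> measurable_fun setT x ->
  measurable_fun setT t -> measurable_fun setT y ->
  measurable_fun setT (fun w => p (s w) (x w) (t w) (y w)).
Proof.
move=> mp ms mx mt my.
have mf : measurable_fun setT (fun w => ((s w, x w), (t w, y w))).
  by apply: measurable_fun_pair; apply: measurable_fun_pair.
exact: (measurableT_comp mp mf).
Qed.

Lemma measurable_potential_comp (q : R -> X -> \bar R) dT
    (T : measurableType dT) (s : T -> R) (x : T -> X) :
  measurable_fun [set: R * X] (fun w : R * X => q w.1 w.2) ->
  measurable_fun setT s -> measurable_fun setT x ->
  measurable_fun setT (fun w => q (s w) (x w)).
Proof.
by move=> mq ms mx; exact: (measurableT_comp mq (measurable_fun_pair ms mx)).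
Qed.

(** One interaction with [q], followed by the kernel [k]: the operator
    whose powers generate the terms of the perturbation series. *)
Definition duhamel (p : kernel_fun R d) (q : R -> X -> \bar R)
    (k : kernel_fun R d) : kernel_fun R d := fun s x t y =>
  \int[leb]_(u in `]s, t[) \int[lebd]_z (p s x u z * q u z * k u z t y).

(** Iterating k |-> p + T k from zero gives the partial sums of the
    series.  Working with them instead of the single terms turns both the
    geometric series and the convolution of two series into inductions. *)
Fixpoint picard p q (n : nat) : kernel_fun R d :=
  if n is n'.+1 then
    fun s x t y => p s x t y + duhamel p q (picard p q n') s x t y
  else fun _ _ _ _ => 0.

Section nonneg.
Variables (p : kernel_fun R d) (q : R -> X -> \bar R).
Hypothesis p0 : forall s x t y, 0 <= p s x t y.
Hypothesis mp : kernel_measurable p.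
Hypothesis q0 : forall u z, 0 <= q u z.
Hypothesis mq : measurable_fun [set: R * X] (fun w : R * X => q w.1 w.2).

Ltac mproj := solve [
  repeat first [ exact: measurable_id | exact: measurable_cst
  | exact: measurable_fst | exact: measurable_snd
  | apply: measurable_funB | apply: measurable_fun_ltr
  | apply: (@measurableT_comp _ _ _ _ _ _ fst)
  | apply: (@measurableT_comp _ _ _ _ _ _ snd) ]].

Ltac mker := repeat first [ apply: emeasurable_funM
  | apply: measurable_kernel_comp => //; mproj
  | apply: measurable_potential_comp => //; mproj ].

Lemma duhamel_ge0 (k : kernel_fun R d) :
  (forall s x t y, 0 <= k s x t y) -> forall s x t y, 0 <= duhamel p q k s x t y.
Proof.
move=> k0 s x t y; apply: integral_ge0 => u _; apply: integral_ge0 => z _.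
by rewrite !mule_ge0.
Qed.

Lemma measurable_duhamel (k : kernel_fun R d) :
  (forall s x t y, 0 <= k s x t y) -> kernel_measurable k ->
  kernel_measurable (duhamel p q k).
Proof.
move=> k0 mk; rewrite /kernel_measurable /duhamel.
pose F (w : (R * X) * (R * X)) (u : R) : \bar R :=
  if (w.1.1 < u)%R && (u < w.2.1)%R then
    \int[lebd]_z (p w.1.1 w.1.2 u z * q u z * k u z w.2.1 w.2.2)
  else 0.
rewrite (_ : (fun _ => _) = fun w => \int[leb]_u F w u); last first.
  apply/funext => w; rewrite integral_mkcond; apply: eq_integral => u _.
  rewrite /patch /F; case: ifPn.
    by rewrite inE/= in_itv/= => ->.
  by move=> /negP; rewrite inE/= in_itv/=; case: ifP.
apply: measurable_integral2; last first.
  move=> w u; rewrite /F; case: ifP => // _.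
  by apply: integral_ge0 => z _; rewrite !mule_ge0.
apply: measurable_fun_ifT => //.
  by apply: measurable_and; mproj.
apply: (@measurable_integral2 _ _ _ _ _ lebd (fun w z =>
  p w.1.1.1 w.1.1.2 w.2 z * q w.2 z * k w.2 z w.1.2.1 w.1.2.2)).
  by mker.
by move=> *; rewrite !mule_ge0.
Qed.

Lemma duhamel_le (k k' : kernel_fun R d) s x t y :
  (forall s x t y, 0 <= k s x t y) ->
  (forall u z, (s < u < t)%R -> k u z t y <= k' u z t y) ->
  duhamel p q k s x t y <= duhamel p q k' s x t y.
Proof.
move=> k0 kk'; apply: ge0_integral_mono => u.
  by move=> _; apply: integral_ge0 => z _; rewrite !mule_ge0.
move=> /=; rewrite in_itv/= => sut; apply: ge0_integral_mono => z _.
  by rewrite !mule_ge0.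
by rewrite lee_wpmul2l ?mule_ge0//; exact: kk'.
Qed.

Lemma duhamelD (k k' : kernel_fun R d) s x t y :
  (forall s x t y, 0 <= k s x t y) -> kernel_measurable k ->
  (forall s x t y, 0 <= k' s x t y) -> kernel_measurable k' ->
  duhamel p q (fun s x t y => k s x t y + k' s x t y) s x t y =
  duhamel p q k s x t y + duhamel p q k' s x t y.
Proof.
move=> k0 mk k'0 mk'; rewrite /duhamel -ge0_integralD//=.
- apply: eq_integral => u _; rewrite -ge0_integralD//=.
  + by apply: eq_integral => z _; rewrite ge0_muleDr.
  + by move=> *; rewrite !mule_ge0.
  + by mker.
  + by move=> *; rewrite !mule_ge0.
  + by mker.
- by move=> u _; apply: integral_ge0 => *; rewrite !mule_ge0.
- apply: measurable_funTS; apply: measurable_integral2 => [|*].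
    by mker.
  by rewrite !mule_ge0.
- by move=> u _; apply: integral_ge0 => *; rewrite !mule_ge0.
- apply: measurable_funTS; apply: measurable_integral2 => [|*].
    by mker.
  by rewrite !mule_ge0.
Qed.

Lemma picard_ge0 n s x t y : 0 <= picard p q n s x t y.
Proof.
elim: n s x t y => //= n IH s x t y; rewrite adde_ge0//; exact: duhamel_ge0.
Qed.

Lemma measurable_picard n : kernel_measurable (picard p q n).
Proof.
elim: n => [|n IH]; first exact: measurable_cst.
apply: emeasurable_funD => //; apply: measurable_duhamel => //.
exact: picard_ge0.
Qed.

Lemma perturbation_term_ge0 n s x t y : 0 <= perturbation_term p q n s x t y.
Proof. by elim: n s x t y => //= n IH; exact: duhamel_ge0. Qed.

Lemma measurable_perturbation_term n :
  kernel_measurable (perturbation_term p q n).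
Proof.
elim: n => [//|n IH]; apply: measurable_duhamel => //.
exact: perturbation_term_ge0.
Qed.

Lemma sum_perturbation_term n s x t y :
  \sum_(0 <= i < n) perturbation_term p q i s x t y = picard p q n s x t y.
Proof.
elim: n s x t y => [|n IH] s x t y; first by rewrite big_geq.
rewrite big_nat_recl//=; congr (_ + _).
rewrite (_ : picard p q n = fun s x t y =>
  \sum_(0 <= i < n) perturbation_term p q i s x t y); last first.
  by do 4 apply/funext => ?; rewrite IH.
elim: n {IH} => [|n IH].
  rewrite big_geq// /duhamel integral0_eq// => u _.
  by rewrite integral0_eq// => z _; rewrite big_geq// mule0.
pose S s x t y := \sum_(0 <= i < n) perturbation_term p q i s x t y.
rewrite [RHS](_ : _ = duhamel p q
  (fun s x t y => S s x t y + perturbation_term p q n s x t y) s x t y);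
  last first.
  congr (duhamel p q _ s x t y); do 4 apply/funext => ?.
  by rewrite big_nat_recr.
rewrite duhamelD.
- by rewrite big_nat_recr//= IH.
- by move=> *; apply: sume_ge0 => *; exact: perturbation_term_ge0.
- rewrite /S; elim: n {IH S} => [|n IH].
    rewrite /kernel_measurable; under eq_fun do rewrite big_geq//.
    exact: measurable_cst.
  rewrite /kernel_measurable; under eq_fun do rewrite big_nat_recr//=.
  by apply: emeasurable_funD => //; exact: measurable_perturbation_term.
- exact: perturbation_term_ge0.
- exact: measurable_perturbation_term.
Qed.

Lemma picard_leS n s x t y : picard p q n s x t y <= picard p q n.+1 s x t y.
Proof.
elim: n s x t y => [|n IH] s x t y; first exact: picard_ge0.
rewrite [leLHS]/= [leRHS]/= leeD2l//; apply: duhamel_le => //.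
exact: picard_ge0.
Qed.


(** If the first interaction happens before [u] and the rest of
    the path factors at time [u], the factor after [u] can be pulled out. *)
Lemma duhamel_comp_l (k1 k2 : kernel_fun R d) s x u t y :
  (forall s x t y, 0 <= k1 s x t y) -> kernel_measurable k1 ->
  (forall s x t y, 0 <= k2 s x t y) -> kernel_measurable k2 ->
  \int[leb]_(v in `]s, u[) \int[lebd]_z
    (p s x v z * q v z * \int[lebd]_w (k1 v z u w * k2 u w t y)) =
  \int[lebd]_w (duhamel p q k1 s x u w * k2 u w t y).
Proof.
move=> k10 mk1 k20 mk2.
pose F v z w := p s x v z * q v z * k1 v z u w * k2 u w t y.
have F0 v z w : 0 <= F v z w by rewrite /F !mule_ge0.
transitivity (\int[leb]_(v in `]s, u[) \int[lebd]_w \int[lebd]_z F v z w).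
  apply: eq_integral => v _; rewrite -(tonelli_in lebd lebd (f := F v))//.
    apply: eq_integral => z _; rewrite -ge0_integralZl//=.
    - by apply: eq_integral => w _; rewrite /F !muleA.
    - by mker.
    - by move=> *; rewrite mule_ge0.
    - by rewrite mule_ge0.
  by rewrite /F; mker.
rewrite (tonelli_in leb lebd (f := fun v w => \int[lebd]_z F v z w))//.
- apply: eq_integral => w _; rewrite -ge0_integralZr//=.
  + apply: eq_integral => v _; rewrite -ge0_integralZr//=.
    * by mker.
    * by move=> *; rewrite !mule_ge0.
  + apply: measurable_funTS; apply: measurable_integral2 => [|*].
      by mker.
    by rewrite !mule_ge0.
  + by move=> *; apply: integral_ge0 => *; rewrite !mule_ge0.
- apply: (@measurable_integral2 _ _ _ _ _ lebd (fun w z => F w.1 z w.2)) => //.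
  by rewrite /F; mker.
- by move=> *; exact: integral_ge0.
Qed.

(** If the first interaction happens after [u], the free motion
    before it factors at time [u] by the Chapman-Kolmogorov equation. *)
Lemma duhamel_comp_r (k : kernel_fun R d) s x u t y :
  (forall s x t y, 0 <= k s x t y) -> kernel_measurable k ->
  \int[leb]_(v in `]u, t[) \int[lebd]_z
    ((\int[lebd]_w (p s x u w * p u w v z)) * q v z * k v z t y) =
  \int[lebd]_w (p s x u w * duhamel p q k u w t y).
Proof.
move=> k0 mk.
pose F v z w := p s x u w * (p u w v z * q v z * k v z t y).
have F0 v z w : 0 <= F v z w by rewrite /F !mule_ge0.
transitivity (\int[leb]_(v in `]u, t[) \int[lebd]_w \int[lebd]_z F v z w).
  apply: eq_integral => v _; rewrite -(tonelli_in lebd lebd (f := F v))//.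
    apply: eq_integral => z _; rewrite -muleA -ge0_integralZr//=.
    - by apply: eq_integral => w _; rewrite /F !muleA.
    - by mker.
    - by move=> *; rewrite mule_ge0.
    - by rewrite mule_ge0.
  by rewrite /F; mker.
rewrite (tonelli_in leb lebd (f := fun v w => \int[lebd]_z F v z w))//.
- apply: eq_integral => w _; rewrite -ge0_integralZl//=.
  + apply: eq_integral => v _; rewrite -ge0_integralZl//=.
    * by mker.
    * by move=> *; rewrite !mule_ge0.
  + apply: measurable_funTS; apply: measurable_integral2 => [|*].
      by mker.
    by rewrite !mule_ge0.
  + by move=> *; apply: integral_ge0 => *; rewrite !mule_ge0.
- apply: (@measurable_integral2 _ _ _ _ _ lebd (fun w z => F w.1 z w.2)) => //.
  by rewrite /F; mker.
- by move=> *; exact: integral_ge0.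
Qed.

(** A first interaction in ]s,t[ takes place either before or
    after a given intermediate time [u]. *)
Lemma duhamel_split (k : kernel_fun R d) s x u t y :
  (forall s x t y, 0 <= k s x t y) -> kernel_measurable k ->
  (s < u)%R -> (u < t)%R ->
  duhamel p q k s x t y =
  \int[leb]_(v in `]s, u[) \int[lebd]_z (p s x v z * q v z * k v z t y) +
  \int[leb]_(v in `]u, t[) \int[lebd]_z (p s x v z * q v z * k v z t y).
Proof.
move=> k0 mk su ut; rewrite /duhamel.
have mF D : measurable_fun D
    (fun v => \int[lebd]_z (p s x v z * q v z * k v z t y)).
  apply: measurable_funTS; apply: measurable_integral2 => [|*].
    by mker.
  by rewrite !mule_ge0.
have -> : `]s, t[%classic = `]s, u] `|` `]u, t[ :> set R.
  by rewrite -itv_bndbnd_setU// bnd_simp ltW.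
rewrite ge0_integral_setU//=.
- by congr (_ + _); rewrite integral_itv_bndo_bndc//; exact: mF.
- exact: mF.
- by move=> v _; apply: integral_ge0 => *; rewrite !mule_ge0.
- rewrite disj_set2E; apply/eqP; rewrite -subset0 => v [] /=.
  by rewrite !in_itv/= => /andP[_ vu] /andP[/lt_geF]; rewrite vu.
Qed.

Lemma integral_kernelDl (k1 k2 k : kernel_fun R d) s x u t y :
  (forall s x t y, 0 <= k1 s x t y) -> kernel_measurable k1 ->
  (forall s x t y, 0 <= k2 s x t y) -> kernel_measurable k2 ->
  (forall s x t y, 0 <= k s x t y) -> kernel_measurable k ->
  \int[lebd]_w ((k1 s x u w + k2 s x u w) * k u w t y) =
  \int[lebd]_w (k1 s x u w * k u w t y) + \int[lebd]_w (k2 s x u w * k u w t y).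
Proof.
move=> k10 mk1 k20 mk2 k0 mk.
rewrite -[RHS]ge0_integralD//.
- by apply: eq_integral => w _; rewrite ge0_muleDl.
- by move=> w _; apply: mule_ge0.
- by mker.
- by move=> w _; apply: mule_ge0.
- by mker.
Qed.

Lemma integral_kernelDr (k k1 k2 : kernel_fun R d) s x u t y :
  (forall s x t y, 0 <= k s x t y) -> kernel_measurable k ->
  (forall s x t y, 0 <= k1 s x t y) -> kernel_measurable k1 ->
  (forall s x t y, 0 <= k2 s x t y) -> kernel_measurable k2 ->
  \int[lebd]_w (k s x u w * (k1 u w t y + k2 u w t y)) =
  \int[lebd]_w (k s x u w * k1 u w t y) + \int[lebd]_w (k s x u w * k2 u w t y).
Proof.
move=> k0 mk k10 mk1 k20 mk2.
rewrite -[RHS]ge0_integralD//.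
- by apply: eq_integral => w _; rewrite ge0_muleDr.
- by move=> w _; apply: mule_ge0.
- by mker.
- by move=> w _; apply: mule_ge0.
- by mker.
Qed.

Hypothesis CK : forall s u t x y, (s < u)%R -> (u < t)%R ->
  \int[lebd]_z (p s x u z * p u z t y) = p s x t y.

(** At time [u] a path with at most n interactions splits into two
    paths with at most n interactions.  Conversely two such paths may together
    have more than n interactions, which is why this is an inequality. *)
Lemma picard_subCK n s x u t y : (s < u)%R -> (u < t)%R ->
  picard p q n s x t y <=
  \int[lebd]_w (picard p q n s x u w * picard p q n u w t y).
Proof.
elim: n s x u t y => [|n IH] s x u t y su ut.
  by apply: integral_ge0 => *; rewrite mule0.
have S0 := picard_ge0; have mS := measurable_picard.
have D0 m := duhamel_ge0 (S0 m).
have mD m := measurable_duhamel (S0 m) (mS m).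
pose D := duhamel p q (picard p q n).
have mDn : kernel_measurable D := mD n.
have mS1 := mS n.+1.
have E1 : \int[lebd]_w (p s x u w * picard p q n.+1 u w t y) =
    p s x t y + \int[lebd]_w (p s x u w * D u w t y).
  by rewrite -(CK _ _ su ut); exact: integral_kernelDr.
have E2 : \int[lebd]_w (picard p q n.+1 s x u w * picard p q n.+1 u w t y) =
    \int[lebd]_w (p s x u w * picard p q n.+1 u w t y) +
    \int[lebd]_w (D s x u w * picard p q n.+1 u w t y).
  exact: (integral_kernelDl _ _ _ _ _ p0 mp (D0 n) mDn (S0 n.+1) mS1).
rewrite [leLHS]/= (duhamel_split _ _ (S0 n) (mS n) su ut).
rewrite E2 E1.
have add5 (a b c e f : \bar R) : c <= e -> b <= f -> a + (b + c) <= a + e + f.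
  by move=> ce bf; rewrite -addeA leeD2l// addeC leeD.
apply: add5.
  rewrite -duhamel_comp_r//; apply: ge0_integral_mono => v.
    by move=> _; apply: integral_ge0 => *; rewrite !mule_ge0.
  rewrite /= in_itv/= => /andP[uv vt]; rewrite le_eqVlt; apply/orP; left.
  by apply/eqP; apply: eq_integral => z _; rewrite CK.
apply: (@le_trans _ _ (\int[lebd]_w (D s x u w * picard p q n u w t y))); last first.
  apply: ge0_integral_mono => w _.
    by apply: mule_ge0; [exact: D0|exact: S0].
  by apply: lee_wpmul2l; [exact: D0|exact: picard_leS].
rewrite -duhamel_comp_l//; apply: ge0_integral_mono => v.
  by move=> _; apply: integral_ge0 => *; rewrite !mule_ge0.
rewrite /= in_itv/= => /andP[sv vu]; apply: ge0_integral_mono => z _.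
  by rewrite !mule_ge0.
by apply: lee_wpmul2l; [rewrite mule_ge0|exact: IH].
Qed.

Section bound.
Variables (r : kernel_fun R d) (C eta : R) (Q : R -> R -> R).
Hypothesis r0 : forall s x t y, 0 <= r s x t y.
Hypothesis mr : kernel_measurable r.
Hypothesis rCK : forall s u t x y, (s < u)%R -> (u < t)%R ->
  \int[lebd]_z (r s x u z * r u z t y) = r s x t y.
Hypothesis C1 : (1 <= C)%R.
Hypothesis eta0 : (0 <= eta)%R.
Hypothesis Qsa : regular_superadditive Q.
Hypothesis pr : forall s t x y, (s < t)%R -> p s x t y <= C%:E * r s x t y.
Hypothesis pqr : forall s t x y, (s < t)%R ->
  duhamel p q r s x t y <= (eta + Q s t)%:E * r s x t y.
Variable eps : R.
Hypothesis eps0 : (0 < eps)%R.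
Hypothesis eps1 : (eps < 1 - eta)%R.

Let B := (C / (1 - eta - eps))%R.

Let den_gt0 : (0 < 1 - eta - eps)%R.
Proof. by rewrite subr_gt0. Qed.

Let B1 : (1 <= B)%R.
Proof.
rewrite /B ler_pdivlMr// mul1r (le_trans _ C1)//.
by rewrite -addrA gerDl -opprD oppr_le0 addr_ge0// ltW.
Qed.

Lemma duhamelZ (c : R) (k : kernel_fun R d) s x t y : (0 <= c)%R ->
  (forall s x t y, 0 <= k s x t y) -> kernel_measurable k ->
  duhamel p q (fun s x t y => c%:E * k s x t y) s x t y =
  c%:E * duhamel p q k s x t y.
Proof.
move=> c0 k0 mk; rewrite /duhamel -[RHS]ge0_integralZl//.
- apply: eq_integral => u _; rewrite -[RHS]ge0_integralZl//.
  + by apply: eq_integral => z _; rewrite muleCA.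
  + by mker.
  + by move=> *; rewrite !mule_ge0.
- apply: measurable_funTS; apply: measurable_integral2 => [|*].
    by mker.
  by rewrite !mule_ge0.
- by move=> *; apply: integral_ge0 => *; rewrite !mule_ge0.
Qed.

(** The constant B is the fixed point of
    B = C + (eta + eps) B, and this is exactly what the induction step needs.
    Superadditivity guarantees that Q(u,t) <= eps persists for s < u < t. *)
Lemma picard_le_short n s x t y : (s < t)%R -> (Q s t <= eps)%R ->
  picard p q n s x t y <= B%:E * r s x t y.
Proof.
have B0 : (0 <= B)%R by rewrite (le_trans _ B1).
elim: n s x t y => [|n IH] s x t y st Qst.
  by rewrite mule_ge0// lee_fin.
have -> : B = (C + B * (eta + eps))%R.
  by rewrite /B; field; rewrite gt_eqF.
rewrite EFinD EFinM ge0_muleDl ?lee_fin//; last 2 first.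
- by rewrite (le_trans _ C1).
- by rewrite mulr_ge0// addr_ge0// ltW.
rewrite [leLHS]/=; apply: leeD; first exact: pr.
apply: (@le_trans _ _ (duhamel p q (fun s x t y => B%:E * r s x t y) s x t y)).
  apply: duhamel_le => //; first exact: picard_ge0.
  move=> u z /andP[su ut]; apply: IH => //; apply: le_trans Qst.
  apply: le_trans (superadditiveD Qsa su ut).
  by rewrite lerDr; exact: superadditive_ge0.
rewrite duhamelZ// -muleA lee_wpmul2l// ?lee_fin//.
apply: le_trans (pqr _ _ st) _; rewrite lee_wpmul2r// lee_fin lerD2l//.
Qed.

(** Induction on the number of pieces on which [Q] is at most
    [eps]; fewer pieces are covered as well because B >= 1. *)
Lemma picard_le_pow n k s x t y : (s < t)%R -> (Q s t <= eps *+ k.+1)%R ->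
  picard p q n s x t y <= (B ^+ k.+1)%:E * r s x t y.
Proof.
have B0 : (0 <= B)%R by rewrite (le_trans _ B1).
elim: k s x t y => [|k IH] s x t y st Qst; first exact: picard_le_short.
have [Qe|Qe] := leP (Q s t) eps.
  apply: le_trans (picard_le_short _ _ _ st Qe) _.
  by rewrite lee_wpmul2r// lee_fin exprS ler_peMr// exprn_ege1.
have [u [su ut Qsu Qut]] : exists u, [/\ s < u, u < t, Q s u <= eps &
    Q u t <= Q s t - eps]%R by exact: superadditive_cut.
apply: le_trans (picard_subCK _ _ _ su ut) _.
rewrite -(rCK _ _ su ut) exprS EFinM -ge0_integralZl//; last 3 first.
- by mker.
- by move=> *; rewrite mule_ge0.
- by rewrite lee_fin mulr_ge0// exprn_ge0.
apply: ge0_integral_mono => z _.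
  by rewrite mule_ge0//; exact: picard_ge0.
rewrite muleACA; apply: lee_pmul; try exact: picard_ge0.
  exact: picard_le_short.
apply: IH => //; apply: (le_trans Qut).
by rewrite lerBlDr -mulrSr.
Qed.

(** The number of pieces is one plus the integer part of
    Q(s,t) / eps. *)
Theorem schrodinger_le s x t y : (s < t)%R ->
  schrodinger_perturbation p q s x t y <=
  (B `^ (1 + Q s t / eps))%:E * r s x t y.
Proof.
move=> st; have Q0 := superadditive_ge0 Qsa s t.
have Qe0 : (0 <= Q s t / eps)%R by rewrite divr_ge0// ltW.
rewrite /schrodinger_perturbation; apply: lime_le.
  by apply: is_cvg_nneseries => *; exact: perturbation_term_ge0.
apply: nearW => n; rewrite sum_perturbation_term//.
pose k := Num.truncn (Q s t / eps).
have Qk : (Q s t <= eps *+ k.+1)%R.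
  rewrite -mulr_natr -ler_pdivrMl// mulrC.
  by rewrite ltW// /k truncnS_gt.
apply: le_trans (picard_le_pow n _ _ st Qk) _.
rewrite lee_wpmul2r// lee_fin -powR_mulrn ?(le_trans _ B1)//.
rewrite ler_powR// -natr1 addrC lerD2l.
by rewrite truncn_le.
Qed.

End bound.
End nonneg.
End perturbation.

(** * Lebesgue measure on tuples *)

Section lebesgue_tuple_theory.
Variable R : realType.
Local Notation leb := (@lebesgue_measure R).
Local Open Scope ereal_scope.

(** Lebesgue measure on (n+1)-tuples is by
    construction an image of a product measure; this unfolding of one
    coordinate drives all inductions on the dimension. *)
Lemma ge0_integral_lebesgue_tupleS n (f : n.+1.-tuple R -> \bar R) :
  measurable_fun setT f -> (forall x, 0 <= f x) ->
  \int[lebesgue_tuple R n.+1]_x f x =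
  \int[leb]_x \int[lebesgue_tuple R n]_v f (consT (x, v)).
Proof.
move=> mf f0.
have mc : measurable_fun setT (f \o @consT R n).
  by apply: measurableT_comp => //; exact: measurable_consT.
transitivity (\int[leb \x lebesgue_tuple R n]_w (f \o @consT R n) w).
  have mphi : measurable_fun [set: measurableTypeR R * n.-tuple R] (@consT R n).
    exact: measurable_consT.
  have E := @ge0_integral_pushforward _ _ (measurableTypeR R * n.-tuple R)%type
    _ R _ mphi (leb \x lebesgue_tuple R n) setT f measurableT mf (fun x _ => f0 x).
  by rewrite preimage_setT in E.
exact: (fubini_tonelli1 (m1 := leb) (m2 := lebesgue_tuple R n) _ mc
  (fun _ => f0 _)).
Qed.

Lemma measurable_prod_tnth n (f : 'I_n -> R -> R) :
  (forall i, measurable_fun setT (f i)) ->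
  measurable_fun [set: n.-tuple R] (fun t => \prod_(i < n) f i (tnth t i))%R.
Proof.
move=> mf; apply: measurable_prod => i _.
exact: (measurableT_comp (mf i) (measurable_tnth i)).
Qed.

Lemma ge0_integral_prod_tuple n (f : 'I_n -> R -> R) (J : 'I_n -> R) :
  (forall i, measurable_fun setT (f i)) -> (forall i x, (0 <= f i x)%R) ->
  (forall i, \int[leb]_x (f i x)%:E = (J i)%:E) ->
  \int[lebesgue_tuple R n]_z (\prod_(i < n) f i (tnth z i))%:E =
  (\prod_(i < n) J i)%:E.
Proof.
elim: n f J => [|n IH] f J mf f0 fJ.
  rewrite big_ord0; under eq_integral do rewrite big_ord0.
  by rewrite integral_cst//= diracT mul1e.
rewrite ge0_integral_lebesgue_tupleS; last 2 first.
- by apply/measurable_EFinP; exact: measurable_prod_tnth.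
- by move=> x; rewrite lee_fin; apply: prodr_ge0.
rewrite big_ord_recl EFinM -(IH (fun i => f (lift ord0 i)))//.
rewrite -(fJ ord0) -ge0_integralZr//; last 3 first.
- by apply/measurable_EFinP; exact: (mf ord0).
- by move=> x _; rewrite lee_fin.
- by apply: integral_ge0 => z _; rewrite lee_fin; apply: prodr_ge0.
apply: eq_integral => x _; rewrite -ge0_integralZl//; last 3 first.
- by apply/measurable_EFinP; exact: (@measurable_prod_tnth n (fun i => f (lift ord0 i))).
- by move=> z _; rewrite lee_fin; apply: prodr_ge0.
- by rewrite lee_fin.
apply: eq_integral => v _; rewrite big_ord_recl EFinM /consT/=.
by congr (_ * _%:E); apply: eq_bigr => i _; rewrite tnthS.
Qed.

Section affine.
Variables (c : R).
Hypothesis c0 : (0 < c)%R.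

Lemma measurable_affine (v : R) : measurable_fun setT (fun x : R => c * x + v)%R.
Proof. by apply: measurable_funD => //; apply: measurable_funM. Qed.

(** Both sides are measures in [A], so it is enough to
    compare them on half-open intervals. *)
Lemma lebesgue_measure_affine (v : R) (A : set R) : measurable A ->
  leb A = c%:E * leb ((fun x => c * x + v)%R @^-1` A).
Proof.
have c0' : (0 <= c)%R by exact: ltW.
pose m := mscale (NngNum c0')
  (pushforward leb (fun x : R => c * x + v : measurableTypeR R)%R).
move=> mA; transitivity (m (measurable_affine v) A); last by [].
apply: (@lebesgue_measure_unique R) => // X [[a b] _ <-].
rewrite [RHS](_ : _ = c%:E * leb ((fun x => c * x + v)%R @^-1` `]a, b]))//.
rewrite (_ : _ @^-1` _ = `](a - v) / c, (b - v) / c]%classic)%R; last first.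
  apply/seteqP; split => x /=; rewrite !in_itv/=;
    by rewrite ltr_pdivrMr// ler_pdivlMr// mulrC ltrBlDr lerBrDr.
rewrite !lebesgue_measure_itv/= !lte_fin ltr_pM2r ?invr_gt0// ltrD2r.
case: ifP => _; last by rewrite mule0.
by rewrite -EFinD -EFinM; congr EFin; field; rewrite gt_eqF.
Qed.

Lemma ge0_integral_affine (v : R) (f : R -> \bar R) :
  measurable_fun setT f -> (forall x, 0 <= f x) ->
  \int[leb]_x f x = c%:E * \int[leb]_x f (c * x + v)%R.
Proof.
move=> mf f0.
have c0' : (0 <= c)%R by exact: ltW.
have := @ge0_integral_pushforward _ _ (measurableTypeR R) (measurableTypeR R) R
  (fun x : R => c * x + v)%R (measurable_affine v)
  leb setT f measurableT mf (fun x _ => f0 x).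
rewrite preimage_setT => E; rewrite -[X in c%:E * X]E.
pose m := mscale (NngNum c0')
  (pushforward leb (fun x : R => c * x + v : measurableTypeR R)%R).
transitivity (\int[m (measurable_affine v)]_x f x); last first.
  exact: ge0_integral_mscale.
by apply: eq_measure_integral => A mA _; exact: lebesgue_measure_affine.
Qed.

Definition affine_tuple n (v : n.-tuple R) (t : n.-tuple R) : n.-tuple R :=
  [tuple c * tnth t i + tnth v i | i < n]%R.

Lemma measurable_affine_tuple n (v : n.-tuple R) :
  measurable_fun setT (affine_tuple v).
Proof.
apply/measurable_fun_tnthP => i.
rewrite (_ : _ \o _ = (fun x => c * x + tnth v i)%R \o (fun t => tnth t i)).
  by apply: measurableT_comp; [exact: measurable_affine|exact: measurable_tnth].
by apply/funext => t /=; rewrite tnth_mktuple.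
Qed.

Lemma ge0_integral_affine_tuple n (v : n.-tuple R) (f : n.-tuple R -> \bar R) :
  measurable_fun setT f -> (forall x, 0 <= f x) ->
  \int[lebesgue_tuple R n]_x f x =
  (c ^+ n)%:E * \int[lebesgue_tuple R n]_x f (affine_tuple v x).
Proof.
elim: n v f => [|n IH] v f mf f0.
  rewrite expr0 mul1e; apply: eq_integral => x _; congr f.
  by rewrite [x]tuple0 [RHS]tuple0.
have mfa : measurable_fun setT (fun x => f (affine_tuple v x)).
  by apply: measurableT_comp => //; exact: measurable_affine_tuple.
rewrite !ge0_integral_lebesgue_tupleS//.
have mfc : measurable_fun setT (f \o @consT R n).
  by apply: measurableT_comp => //; exact: measurable_consT.
have mi : measurable_fun setT (fun x => \int[lebesgue_tuple R n]_w f (consT (x, w))).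
  apply: (@measurable_integral2 _ _ _ _ _ (lebesgue_tuple R n)
    (fun x w => f (consT (x, w)))) => //.
have mi0 x : 0 <= \int[lebesgue_tuple R n]_w f (consT (x, w)).
  exact: integral_ge0.
rewrite (ge0_integral_affine (tnth v ord0))// exprS EFinM -muleA; congr (_ * _).
pose w : n.-tuple R := [tuple of behead v].
rewrite -ge0_integralZl//; last 3 first.
- apply: (@measurable_integral2 _ _ _ _ _ (lebesgue_tuple R n)
    (fun x z => f (affine_tuple v (consT (x, z))))) => //.
  exact: (measurableT_comp mfa (@measurable_consT R n)).
- by move=> *; exact: integral_ge0.
- by rewrite lee_fin exprn_ge0// ltW.
apply: eq_integral => x _; rewrite (IH w)//; last first.
  exact: (measurable_fun_pair2 _ mfc).
congr (_ * _); apply: eq_integral => z _; congr f.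
apply: eq_from_tnth => i; rewrite [in RHS]tnth_mktuple.
case: (unliftP ord0 i) => [j ->|->//].
rewrite !tnthS tnth_mktuple tnth_behead; congr (_ + tnth v _)%R.
by apply: val_inj; rewrite /= inordK// ltnS.
Qed.

End affine.
End lebesgue_tuple_theory.

(** * Euclidean distance and balls *)

Section euclid.
Variables (R : realType) (d : nat).
Local Notation X := (d.-tuple R).
Local Notation lebd := (lebesgue_tuple R d).

Lemma edist_sqr (x y : X) : edist x y ^+ 2 = \sum_(i < d) (tnth x i - tnth y i) ^+ 2.
Proof. by rewrite sqr_sqrtr// sumr_ge0// => i _; exact: sqr_ge0. Qed.

Lemma edist_nneg (x y : X) : 0 <= edist x y.
Proof. exact: sqrtr_ge0. Qed.

Lemma edistC (x y : X) : edist x y = edist y x.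
Proof.
by congr Num.sqrt; apply: eq_bigr => i _; rewrite -sqrrN opprB.
Qed.

Lemma edistxx (x : X) : edist x x = 0.
Proof.
by rewrite /Defs.edist big1 ?sqrtr0// => i _; rewrite subrr expr0n.
Qed.

Lemma edist_eq0 (x y : X) : edist x y = 0 -> x = y.
Proof.
move=> xy0; apply: eq_from_tnth => i; apply/eqP; rewrite -subr_eq0 -sqrf_eq0.
have : \sum_(i < d) (tnth x i - tnth y i) ^+ 2 == 0.
  by rewrite -edist_sqr xy0 expr0n.
rewrite psumr_eq0; last by move=> *; exact: sqr_ge0.
by move=> /allP/(_ i); rewrite mem_index_enum; exact.
Qed.

Lemma measurable_edist dT (T : measurableType dT) (f g : T -> X) :
  measurable_fun setT f -> measurable_fun setT g ->
  measurable_fun setT (fun w => edist (f w) (g w)).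
Proof.
move=> mf mg; apply: (@measurableT_comp _ _ _ _ _ _ (@Num.sqrt R)) => //.
  apply: continuous_measurable_fun; exact: sqrt_continuous.
apply: measurable_sum => i; apply: (@measurableT_comp _ _ _ _ _ _ (fun x : R => x ^+ 2)) => //.
by apply: measurable_funB; apply: (measurableT_comp (measurable_tnth i)).
Qed.

(** In each coordinate the difference of both sides is
    k^-1 (k u - v)^2.  For a suitable [k] this contains every form of the
    triangle inequality that is needed. *)
Lemma edist_sqr_le (x y z : X) (k : R) : 0 < k ->
  edist x z ^+ 2 <= (1 + k) * edist x y ^+ 2 + (1 + k^-1) * edist y z ^+ 2.
Proof.
move=> k0; rewrite !edist_sqr !mulr_sumr -big_split/=; apply: ler_sum => i _.
set u := tnth x i - tnth y i; set v := tnth y i - tnth z i.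
have -> : tnth x i - tnth z i = u + v by rewrite /u /v; ring.
rewrite -subr_ge0.
have -> : (1 + k) * u ^+ 2 + (1 + k^-1) * v ^+ 2 - (u + v) ^+ 2 =
    (k * u - v) ^+ 2 / k by field; rewrite gt_eqF.
by rewrite divr_ge0 ?sqr_ge0 ?ltW.
Qed.

(** This is the previous inequality for k = m / r. *)
Lemma edist_triangle_lt (x y z : X) (r m : R) : 0 < m ->
  edist x y < r -> edist y z <= m -> edist x z < r + m.
Proof.
move=> m0 xyr yzm.
have r0 : 0 < r by exact: le_lt_trans (edist_nneg _ _) xyr.
rewrite -(@ltr_pXn2r _ 2) ?nnegrE ?edist_nneg ?addr_ge0 ?ltW//.
have xy2 : edist x y ^+ 2 < r ^+ 2.
  by rewrite ltr_pXn2r ?nnegrE ?edist_nneg// ltW.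
have yz2 : edist y z ^+ 2 <= m ^+ 2.
  by rewrite ler_pXn2r ?nnegrE ?edist_nneg// ltW.
have -> : (r + m) ^+ 2 = (1 + m / r) * r ^+ 2 + (1 + r / m) * m ^+ 2.
  by field; rewrite !gt_eqF.
apply: (@le_lt_trans _ _ ((1 + m / r) * edist x y ^+ 2 + (1 + r / m) * edist y z ^+ 2)).
  by rewrite -(invf_div m r); apply: edist_sqr_le; exact: divr_gt0.
have mr : 0 < 1 + m / r by rewrite ltr_wpDr// divr_ge0// ltW.
have rm : 0 <= 1 + r / m by rewrite addr_ge0// divr_ge0// ltW.
by apply: ltr_leD; [rewrite ltr_pM2l|rewrite ler_wpM2l].
Qed.

Lemma edist_affine (c : R) (v x y : X) : 0 <= c ->
  edist (affine_tuple c v x) (affine_tuple c v y) = c * edist x y.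
Proof.
move=> c0; rewrite /edist -[in RHS](ger0_norm c0) -sqrtr_sqr -sqrtrM ?sqr_ge0//.
congr Num.sqrt; rewrite mulr_sumr; apply: eq_bigr => i _.
by rewrite !tnth_mktuple -exprMn; congr (_ ^+ 2); ring.
Qed.

Lemma measurable_edist_ball (x : X) (r : R) : measurable [set z : X | edist z x < r].
Proof.
rewrite -[X in measurable X]setTI.
have := measurable_edist (@measurable_id _ X setT) (@measurable_cst _ _ X X setT x).
move=> /(_ measurableT [set z | z < r]).
by apply; exact: measurable_itv `]-oo, r[.
Qed.

Local Open Scope ereal_scope.

(** The ball is the image of a centred ball under
    z |-> r z + x, which multiplies Lebesgue measure by r^d. *)
Lemma lebesgue_ball (x : X) (r rho : R) : (0 < r)%R ->
  lebd [set z : X | edist z x < r * rho]%R =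
  (r ^+ d)%:E * lebd [set z : X | edist z [tuple of nseq d 0%R] < rho]%R.
Proof.
move=> r0.
have mA := measurable_edist_ball x (r * rho).
have mB := measurable_edist_ball [tuple of nseq d 0%R] rho.
rewrite -[LHS]mul1e -[LHS]integral_cst// -[in RHS](mul1e (lebd _)) -[in RHS]integral_cst//.
rewrite [in LHS]integral_mkcond (ge0_integral_affine_tuple r0 x)//; last 2 first.
- exact/(measurable_restrictT _ _).1.
- by move=> z; rewrite /patch; case: ifP.
congr (_ * _); rewrite [RHS]integral_mkcond; apply: eq_integral => z _.
rewrite /patch/=; congr (if _ then _ else _).
have E : edist (affine_tuple r x z) x = (r * edist z [tuple of nseq d 0%R])%R.
  rewrite -(edist_affine x _ _ (ltW r0)); congr (edist _ _).
  apply: eq_from_tnth => i; rewrite tnth_mktuple (tnth_nth 0%R (nseq_tuple _ _)) /=.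
  by rewrite nth_nseq if_same mulr0 add0r.
by apply/idP/idP; rewrite !inE/= E ltr_pM2l.
Qed.

Lemma lebesgue_box (e : R) : (0 < e)%R ->
  lebd [set z : X | forall i, `](- e)%R, e[%classic (tnth z i)] =
  ((e *+ 2) ^+ d)%:E.
Proof.
move=> e0; rewrite (lebesgue_tuple_box (A := fun=> `](- e)%R, e[%classic)) //.
rewrite (eq_bigr (fun=> (e *+ 2)%:E)); last first.
  move=> i _; rewrite lebesgue_measure_itv/= lte_fin gtrN// -EFinD opprK.
  by rewrite mulr2n.
elim: d => [|n IH]; first by rewrite big_ord0.
by rewrite big_ord_recl IH exprS EFinM.
Qed.

(** The ball lies between two cubes, so that its volume is finite
    and positive and taking its real part loses nothing. *)
Lemma ball_volumeE (rho : R) : (0 < rho)%R ->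
  (0 < ball_volume d rho)%R /\
  lebd [set z : X | edist z [tuple of nseq d 0%R] < rho]%R = (ball_volume d rho)%:E.
Proof.
move=> rho0; set o := [tuple of nseq d 0%R].
have mB := measurable_edist_ball o rho.
have to i : tnth o i = 0%R.
  by rewrite (tnth_nth 0%R (nseq_tuple _ _)) /= nth_nseq if_same.
have mbox e : measurable [set z : X | forall i, `](- e)%R, e[%classic (tnth z i)].
  rewrite (_ : [set _ | _] = \bigcap_(i in [set: 'I_d])
      ((@tnth _ _ ^~ i) @^-1` `](- e)%R, e[%classic)); last first.
    by apply/seteqP; split=> [t h i _|t h i]; exact: h.
  apply: fin_bigcap_measurable => // i _.
  by rewrite -[X in measurable X]setTI; exact: measurable_tnth.
have ub : lebd [set z : X | edist z o < rho]%R <= ((rho *+ 2) ^+ d)%:E.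
  rewrite -lebesgue_box//; apply: le_measure; rewrite ?inE//.
  move=> z /= zr i; rewrite in_itv/= -ltr_norml.
  apply: le_lt_trans zr; rewrite -sqrtr_sqr ler_sqrt.
    by rewrite (bigD1 i)//= to subr0 lerDl sumr_ge0// => *; exact: sqr_ge0.
  by apply: sumr_ge0 => *; exact: sqr_ge0.
have fB : lebd [set z : X | edist z o < rho]%R \is a fin_num.
  by rewrite ge0_fin_numE// (le_lt_trans ub)// ltry.
split; last by rewrite /ball_volume fineK.
(* The cube of half-side e lies in the ball, as d e^2 < (d + 1)^2 e^2; the
   summand 1 avoids a division by zero. *)
pose e := (rho / d.+1%:R)%R.
have e0 : (0 < e)%R by rewrite divr_gt0.
rewrite -lte_fin /ball_volume fineK//.
apply: (@lt_le_trans _ _ ((e *+ 2) ^+ d)%:E).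
  by rewrite lte_fin exprn_gt0// pmulrn_lgt0.
rewrite -lebesgue_box//; apply: le_measure; rewrite ?inE//.
move=> z /= ze; rewrite -(@ltr_pXn2r _ 2) ?nnegrE ?edist_nneg ?ltW//.
rewrite edist_sqr; apply: (@le_lt_trans _ _ (\sum_(i < d) e ^+ 2)%R).
  apply: ler_sum => i _; rewrite to subr0 -[leLHS]real_normK ?num_real//.
  rewrite ler_pXn2r ?nnegrE//; last exact: ltW.
  by have := ze i; rewrite in_itv/= -ltr_norml => /ltW.
rewrite sumr_const card_ord -mulr_natl /e exprMn exprVn mulrCA gtr_pMr ?exprn_gt0//.
rewrite ltr_pdivrMr ?exprn_gt0// mul1r -natrX ltr_nat.
by rewrite -mulnn mulSn ltn_addr.
Qed.

End euclid.

(** * The Gaussian kernel *)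

Section heat.
Variable R : realType.
Local Notation leb := (@lebesgue_measure R).

(** The one-dimensional normal density of variance k / 2, in the
    parametrization in which variances of convolutions add up as k + l. *)
Definition heat (k x : R) : R := (Num.sqrt (pi * k))^-1 * expR (- (x ^+ 2 / k)).

Lemma heat_ge0 k x : 0 <= heat k x.
Proof. by rewrite mulr_ge0 ?invr_ge0 ?sqrtr_ge0 ?expR_ge0. Qed.

Lemma measurable_heat k : measurable_fun setT (heat k).
Proof.
apply: measurable_funM => //; apply: (@measurableT_comp _ _ _ _ _ _ expR) => //.
by apply: measurableT_comp => //; apply: measurable_funM.
Qed.

Lemma heatE k m x : 0 < k -> heat k (x - m) = normal_pdf m (Num.sqrt (k / 2)) x.
Proof.
move=> k0; have k2 : 0 < k / 2 by rewrite divr_gt0.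
rewrite normal_pdfE ?gt_eqF ?sqrtr_gt0// /normal_peak /normal_fun /heat.
rewrite sqr_sqrtr ?ltW//; congr ((Num.sqrt _)^-1 * expR _); field; rewrite ?gt_eqF//.
Qed.

Lemma integral_heat k m : 0 < k -> (\int[leb]_x (heat k (x - m))%:E = 1)%E.
Proof.
move=> k0; under eq_integral do rewrite heatE//.
exact: integral_normal_pdf.
Qed.

(** Completing the square in [z]. *)
Lemma heatM k l x y z : 0 < k -> 0 < l ->
  heat k (z - x) * heat l (y - z) =
  heat (k + l) (y - x) * heat (k * l / (k + l)) (z - (l * x + k * y) / (k + l)).
Proof.
move=> k0 l0; have kl0 : 0 < k + l by rewrite addr_gt0.
rewrite /heat mulrACA [RHS]mulrACA -!invfM -!sqrtrM ?mulr_ge0 ?pi_ge0 ?addr_ge0 ?ltW// -!expRD.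
congr ((Num.sqrt _)^-1 * expR _); field; rewrite ?gt_eqF//.
Qed.

Lemma integral_heatM k l x y : 0 < k -> 0 < l ->
  (\int[leb]_z (heat k (z - x) * heat l (y - z))%:E = (heat (k + l) (y - x))%:E)%E.
Proof.
move=> k0 l0; have kl0 : 0 < k + l by rewrite addr_gt0.
under eq_integral do rewrite heatM// EFinM.
rewrite ge0_integralZl//=; last 3 first.
- apply/measurable_EFinP; apply: (measurableT_comp (measurable_heat _)).
  exact: measurable_funB.
- by move=> z _; rewrite lee_fin heat_ge0.
- by rewrite lee_fin heat_ge0.
by rewrite integral_heat ?mule1// divr_gt0// mulr_gt0.
Qed.
End heat.

Section gauss_kernel.
Variables (R : realType) (d : nat).
Local Notation X := (d.-tuple R).
Local Notation lebd := (lebesgue_tuple R d).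
Variable a : R.
Hypothesis a0 : 0 < a.

Lemma gauss_ge0 s (x : X) t y : (0 <= gauss a s x t y)%E.
Proof.
by rewrite /gauss lee_fin; case: ifP => // _; rewrite mulr_ge0 ?powR_ge0 ?expR_ge0.
Qed.

(** The Gaussian kernel is a product over coordinates; all its
    integrals therefore reduce to dimension one. *)
Lemma gauss_heat s (x : X) t y : s < t ->
  gauss a s x t y =
  (\prod_(i < d) heat (4 * (t - s) / a) (tnth y i - tnth x i))%:E.
Proof.
move=> st; have ts0 : 0 < t - s by rewrite subr_gt0.
rewrite /gauss st; congr EFin; rewrite /heat big_split/=; congr (_ * _).
  rewrite prodr_const card_ord powRN exprVn (mulrC d%:R) powRrM powR12_sqrt.
    rewrite powR_mulrn ?sqrtr_ge0//; congr (Num.sqrt _ ^+ _)^-1; ring.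
  by rewrite divr_ge0 ?mulr_ge0 ?pi_ge0// ltW.
rewrite -expR_sum; congr expR; rewrite sumrN edist_sqr mulr_suml.
by congr (- _); apply: eq_bigr.
Qed.

Lemma measurable_gauss : kernel_measurable (@gauss R d a).
Proof.
rewrite /kernel_measurable (_ : (fun _ => _) = fun w : (R * X) * (R * X) =>
  (if w.1.1 < w.2.1 then
     (4 * pi * (w.2.1 - w.1.1) / a) `^ (- (d%:R / 2)) *
     expR (- (edist w.2.2 w.1.2 ^+ 2 * (4 * (w.2.1 - w.1.1) / a) `^ (- 1)))
   else 0)%:E); last first.
  apply/funext => w; rewrite /gauss; case: ifPn => // st.
  by rewrite powR_inv1// divr_ge0 ?mulr_ge0 ?subr_ge0// ltW.
apply/measurable_EFinP.
have m1 := @measurable_fst _ _ (R * X)%type (R * X)%type.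
have m2 := @measurable_snd _ _ (R * X)%type (R * X)%type.
have ms : measurable_fun setT (fun w : (R * X) * (R * X) => w.1.1).
  exact: (measurableT_comp (@measurable_fst _ _ R X) m1).
have mt : measurable_fun setT (fun w : (R * X) * (R * X) => w.2.1).
  exact: (measurableT_comp (@measurable_fst _ _ R X) m2).
have mx : measurable_fun setT (fun w : (R * X) * (R * X) => w.1.2).
  exact: (measurableT_comp (@measurable_snd _ _ R X) m1).
have my : measurable_fun setT (fun w : (R * X) * (R * X) => w.2.2).
  exact: (measurableT_comp (@measurable_snd _ _ R X) m2).
have mts := measurable_funB mt ms.
apply: measurable_fun_ifT => //; first exact: measurable_fun_ltr.
apply: measurable_funM.
  apply: (@measurableT_comp _ _ _ _ _ _ (fun x : R => x `^ (- (d%:R / 2)))) => //.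
  by apply: measurable_funM => //; apply: measurable_funM.
apply: (@measurableT_comp _ _ _ _ _ _ expR) => //.
apply: measurableT_comp => //; apply: measurable_funM.
  by apply: measurable_funX; exact: measurable_edist.
apply: (@measurableT_comp _ _ _ _ _ _ (fun x : R => x `^ (- 1))) => //.
by apply: measurable_funM => //; apply: measurable_funM.
Qed.

Local Open Scope ereal_scope.

Lemma gauss_CK s u t (x y : X) : (s < u)%R -> (u < t)%R ->
  \int[lebd]_z (gauss a s x u z * gauss a u z t y) = gauss a s x t y.
Proof.
move=> su ut; rewrite (gauss_heat _ _ (lt_trans su ut)).
under eq_integral do rewrite (gauss_heat _ _ su) (gauss_heat _ _ ut) -EFinM -big_split/=.
have k0 : (0 < 4 * (u - s) / a)%R by rewrite divr_gt0// mulr_gt0// subr_gt0.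
have l0 : (0 < 4 * (t - u) / a)%R by rewrite divr_gt0// mulr_gt0// subr_gt0.
rewrite (@ge0_integral_prod_tuple R d (fun i z =>
  heat (4 * (u - s) / a) (z - tnth x i) * heat (4 * (t - u) / a) (tnth y i - z))%R
  (fun i => heat (4 * (t - s) / a) (tnth y i - tnth x i))) => //.
- move=> i; apply: measurable_funM; apply: (measurableT_comp (measurable_heat _));
  exact: measurable_funB.
- by move=> i z; rewrite mulr_ge0 ?heat_ge0.
- move=> i; rewrite integral_heatM//; congr (heat _ _)%:E; field.
  by rewrite gt_eqF.
Qed.

Lemma gauss_transition : transition_density (@gauss R d a).
Proof.
split; [exact: gauss_ge0|exact: measurable_gauss|].
by move=> s u t x y; exact: gauss_CK.
Qed.

Lemma integral_gauss s t (x : X) : (s < t)%R ->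
  \int[lebd]_z gauss a s x t z = 1.
Proof.
move=> st; under eq_integral do rewrite gauss_heat//.
rewrite (@ge0_integral_prod_tuple R d (fun i z =>
  heat (4 * (t - s) / a) (z - tnth x i)) (fun => 1%R)) => //.
- by rewrite prodr_const expr1n.
- by move=> i; apply: (measurableT_comp (measurable_heat _)); exact: measurable_funB.
- by move=> i z; rewrite heat_ge0.
- by move=> i; rewrite integral_heat// divr_gt0// mulr_gt0// subr_gt0.
Qed.

Lemma gaussC s t (x y : X) : gauss a s x t y = gauss a s y t x.
Proof. by rewrite /gauss edistC. Qed.
End gauss_kernel.

(** * A pointwise bound for products of Gaussian kernels *)

Section L_const_theory.
Variable R : realType.

(** A supremum in the reals is only meaningful for sets that are
    bounded above.  Here the logarithmic terms combine to
    ln ((1 + t) / (al t)) + (1 + al) / (1 + t) ln (al t), and both are bounded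
    on the range in question because ln y <= y. *)
Lemma L_const_ub (al tau : R) : 0 < al -> Num.max al al^-1 <= tau ->
  ln (1 + tau) - (tau - al) / (1 + tau) * ln (al * tau) <= L_const al.
Proof.
move=> al0 altau; apply: ub_le_sup; last by exists tau.
exists ((1 + al) / al + (1 + al) * al) => _ [t /= + <-].
rewrite ge_max => /andP[alt al1t].
have t0 : 0 < t by exact: lt_le_trans alt.
have t1 : 0 < 1 + t by rewrite addr_gt0.
have alt0 : 0 < al * t by rewrite mulr_gt0.
have -> : ln (1 + t) - (t - al) / (1 + t) * ln (al * t) =
    ln ((1 + t) / (al * t)) + (1 + al) / (1 + t) * ln (al * t).
  by rewrite ln_div ?posrE//; field; rewrite gt_eqF.
have al1 : 1 <= al * t by rewrite -ler_pdivrMl// mulr1.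
apply: lerD.
  apply: (@le_trans _ _ ((1 + t) / (al * t))).
    by rewrite ltW// ln_sublinear// divr_gt0.
  rewrite ler_pdivrMr// mulrA divfK ?gt_eqF// mulrDl mul1r addrC.
  by rewrite lerD2l.
apply: (@le_trans _ _ ((1 + al) / (1 + t) * (al * t))).
  by rewrite ler_wpM2l ?divr_ge0 ?addr_ge0 ?ltW// ln_sublinear.
rewrite mulrAC ler_pdivrMr// -[leRHS]mulrA ler_wpM2l ?addr_ge0 ?ltW//.
by rewrite ltr_pM2l// ltrDr.
Qed.

(** For sig >= max(al, 1/al) the second alternative holds by
    definition of L.  Otherwise ln (1 + sig) is at most ln (1 + max(al, 1/al)),
    which is the value of the maximised function at the left endpoint of its
    range, since there one of the factors sig - al and ln (al sig) vanishes. *)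
Lemma L_const_interp (al sig : R) : 0 < al -> 0 < sig ->
  ln (1 + sig) <= L_const al \/
  (al <= sig /\ ln (1 + sig) - (sig - al) / (1 + sig) * ln (al * sig) <= L_const al).
Proof.
move=> al0 sig0; have [m_le|m_ge] := leP (Num.max al al^-1) sig; last first.
  left; pose m := Num.max al al^-1.
  have := @L_const_ub al m al0 (lexx _).
  rewrite (_ : (m - al) / (1 + m) * ln (al * m) = 0); last first.
    rewrite /m; case: (leP al al^-1) => _; last by rewrite subrr !mul0r.
    by rewrite divff ?gt_eqF// ln1 mulr0.
  rewrite subr0; apply: le_trans; rewrite ler_ln ?posrE ?addr_gt0//.
    by rewrite lerD2l ltW.
  exact: lt_trans m_ge.
right; split; last exact: L_const_ub.
by apply: le_trans m_le; rewrite le_max lexx.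
Qed.
End L_const_theory.

Section four_gauss.
Variables (R : realType) (d : nat).
Local Notation X := (d.-tuple R).

(** Logarithmic form of the Gaussian kernel, suited to comparing
    products of powers and exponentials by linear arithmetic. *)
Lemma gauss_expR (c s t : R) (x y : X) : 0 < c -> s < t ->
  gauss c s x t y = (expR (- (d%:R / 2 * ln (4 * pi * (t - s) / c)) -
     edist y x ^+ 2 * c / (4 * (t - s))))%:E.
Proof.
move=> c0 st; rewrite /gauss st expRD; congr (_ * expR _)%:E.
  rewrite /powR gt_eqF ?mulNr//.
  by rewrite divr_gt0// !mulr_gt0// ?pi_gt0 ?subr_gt0.
by rewrite invf_div mulrA.
Qed.

(** Here L1, L2 and L are the logarithms of g_(b-a), g_a and
    g_a over time spans A, B and A + B.  The minimum of L1 and L2 is at most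
    w L1 + (1 - w) L2 for every weight w in [0,1].  With al = a / (b - a) and
    sig = A / B, the logarithmic parts of this combination exceed that of L by
    D (ln (1 + sig) - w ln (al sig)); the weight is w = 0 or
    w = (sig - al) / (1 + sig), according to the alternatives of
    [L_const_interp].  In both cases the quadratic parts are dominated by an
    instance of the inequality assumed for all k. *)
Lemma min_exponent_le (a b A B D Xs Ys Zs L1 L2 L : R) :
  0 < a -> a < b -> 0 < A -> 0 < B -> 0 <= D -> 0 <= Xs -> 0 <= Ys ->
  (forall k, 0 < k -> Zs <= (1 + k) * Xs + (1 + k^-1) * Ys) ->
  L1 = - (D * ln (4 * pi * A / (b - a))) - Xs * (b - a) / (4 * A) ->
  L2 = - (D * ln (4 * pi * B / a)) - Ys * a / (4 * B) ->
  L = - (D * ln (4 * pi * (A + B) / a)) - Zs * a / (4 * (A + B)) ->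
  Num.min L1 L2 <= D * L_const (a / (b - a)) + L + Xs * a / (4 * A).
Proof.
move=> a0 ab A0 B0 D0 X0 Y0 quad E1 E2 E.
have b0 : 0 < b by exact: lt_trans ab.
have ba0 : 0 < b - a by rewrite subr_gt0.
have AB0 : 0 < A + B by rewrite addr_gt0.
have BA0 : 0 < B + A by rewrite addr_gt0.
set al := a / (b - a); pose sig := A / B.
have al0 : 0 < al by rewrite divr_gt0.
have sig0 : 0 < sig by rewrite divr_gt0.
have pi0 := pi_gt0 R.
pose P := ln (4 * pi * (A + B) / a); pose l := ln (1 + sig).
pose m := ln (al * sig).
have EB : ln (4 * pi * B / a) = P - l.
  rewrite /P /l -ln_div ?posrE ?divr_gt0 ?mulr_gt0 ?pi_gt0 ?addr_gt0//.
  by congr ln; rewrite /sig; field; rewrite !gt_eqF ?addr_gt0.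
have EA : ln (4 * pi * A / (b - a)) = P - l + m.
  rewrite -EB /m -lnM ?posrE ?divr_gt0 ?mulr_gt0 ?pi_gt0 ?invr_gt0//.
  by congr ln; rewrite /sig /al; field; rewrite !gt_eqF.
rewrite EA in E1; rewrite EB in E2; rewrite -/P in E.
have [lL|[alsig lL]] := L_const_interp al0 sig0.
  apply: (@le_trans _ _ L2); first by rewrite ge_min lexx orbT.
  rewrite E2 E.
  have Dl : D * l <= D * L_const al by rewrite ler_wpM2l.
  have q : Zs * a / (4 * (A + B)) <= Xs * a / (4 * A) + Ys * a / (4 * B).
    have k0 : 0 < B / A by rewrite divr_gt0.
    have := quad _ k0.
    have c0 : 0 < a / (4 * (A + B)) by rewrite divr_gt0// mulr_gt0.
    rewrite -(ler_pM2r c0) => h; rewrite -mulrA; apply: (le_trans h).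
    rewrite le_eqVlt; apply/orP; left; apply/eqP; field.
    by rewrite !gt_eqF.
  lra.
pose w := (sig - al) / (1 + sig).
have w0 : 0 <= w by rewrite divr_ge0 ?subr_ge0// addr_ge0 ?ltW.
have w1 : w <= 1.
  by rewrite /w ler_pdivrMr ?mul1r ?addr_gt0//; lra.
apply: (@le_trans _ _ (w * L1 + (1 - w) * L2)).
  have h1 : Num.min L1 L2 <= L1 by rewrite ge_min lexx.
  have h2 : Num.min L1 L2 <= L2 by rewrite ge_min lexx orbT.
  have w1' : 0 <= 1 - w by rewrite subr_ge0.
  have := ler_wpM2l w0 h1; have := ler_wpM2l w1' h2; lra.
have Dl : D * (l - w * m) <= D * L_const al by rewrite ler_wpM2l.
have q : Zs * a / (4 * (A + B)) <= Xs * a / (4 * A) + w * (Xs * (b - a) / (4 * A))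
    + (1 - w) * (Ys * a / (4 * B)).
  have k0 : 0 < (b - a) / a by rewrite divr_gt0.
  have := quad _ k0.
  have c0 : 0 < a / (4 * (A + B)) by rewrite divr_gt0// mulr_gt0.
  rewrite -(ler_pM2r c0) => h; rewrite -mulrA; apply: (le_trans h).
  rewrite le_eqVlt; apply/orP; left; apply/eqP; rewrite /w /sig /al; field.
  by rewrite !gt_eqF.
rewrite E1 E2 E.
have -> : w * (- (D * (P - l + m)) - Xs * (b - a) / (4 * A)) +
    (1 - w) * (- (D * (P - l)) - Ys * a / (4 * B)) =
   D * (l - w * m) - D * P - w * (Xs * (b - a) / (4 * A)) -
    (1 - w) * (Ys * a / (4 * B)) by ring.
lra.
Qed.

(** Up to the factor (b / (b - a))^(d/2) the kernel g_b is
    g_(b-a) times exp(-a |z - x|^2 / (4 (u - s))).  The exponential compensates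
    the last term in [min_exponent_le], and
    e^L1 e^L2 = e^(max L1 L2) e^(min L1 L2) <= (e^L1 + e^L2) e^(min L1 L2). *)
Lemma gauss_mul_le (a b s u t : R) (x z y : X) : 0 < a -> a < b -> s < u -> u < t ->
  (gauss b s x u z * gauss a u z t y <=
   (M_const d a b)%:E * (gauss (b - a) s x u z + gauss a u z t y) * gauss a s x t y)%E.
Proof.
move=> a0 ab su ut; have st := lt_trans su ut.
have b0 : 0 < b by exact: lt_trans ab.
have ba0 : 0 < b - a by rewrite subr_gt0.
rewrite !gauss_expR// -EFinM -EFinD -!EFinM lee_fin.
set D := d%:R / 2.
have D0 : 0 <= D by rewrite divr_ge0.
have A0 : 0 < u - s by rewrite subr_gt0.
have B0 : 0 < t - u by rewrite subr_gt0.
have quad k : 0 < k -> edist y x ^+ 2 <= (1 + k) * edist z x ^+ 2 + (1 + k^-1) * edist y z ^+ 2.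
  move=> k0; have := edist_sqr_le x z y k0.
  by rewrite (edistC x y) (edistC x z) (edistC z y).
have := min_exponent_le a0 ab A0 B0 D0 (sqr_ge0 (edist z x)) (sqr_ge0 (edist y z))
  quad (erefl _) (erefl _) (erefl _).
have -> : u - s + (t - u) = t - s by ring.
set L1 := - _ - _ * (b - a) / _; set L2 := - _ - edist y z ^+ 2 * a / _.
set L := - (D * ln (4 * pi * (t - s) / a)) - _.
set e := edist z x ^+ 2 * a / _ => minL.
have -> : - (D * ln (4 * pi * (u - s) / b)) - edist z x ^+ 2 * b / (4 * (u - s)) =
    D * ln (b / (b - a)) + L1 - e.
  rewrite /L1 /e (_ : 4 * pi * (u - s) / (b - a) =
      4 * pi * (u - s) / b * (b / (b - a))); last by field; rewrite !gt_eqF.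
  rewrite [X in _ = _ + (- (D * X) - _) - _]lnM ?posrE ?divr_gt0 ?mulr_gt0 ?pi_gt0 ?invr_gt0//.
  by field; rewrite !gt_eqF.
rewrite /M_const -/D /powR gt_eqF ?divr_gt0//.
set r := expR (D * ln (b / (b - a))).
rewrite -addrA expRD -/r; set rL := expR (D * _).
rewrite -!mulrA ler_wpM2l ?expR_ge0//.
rewrite -expRD mulrCA -expRD.
have -> : L1 - e + L2 = Num.max L1 L2 + (Num.min L1 L2 - e).
  by case: (leP L1 L2) => _; ring.
rewrite [leLHS]expRD ler_pM ?expR_ge0//.
  by case: (leP L1 L2) => _; rewrite ?lerDl ?lerDr expR_ge0.
by rewrite ler_expR lerBlDr.
Qed.
End four_gauss.

(** * The time integral of the Gaussian kernel *)

Section half_line.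
Variable R : realType.
Local Notation leb := (@lebesgue_measure R).

Lemma derivable_LRcontinuous (F f : R -> R) (e N : R) : 0 < e -> e < N ->
  (forall x : R, 0 < x -> is_derive x 1 F (f x)) -> derivable_oo_LRcontinuous F e N.
Proof.
move=> e0 eN dF.
have cF (x : R) : 0 < x -> {for x, continuous F}.
  move=> x0; apply: differentiable_continuous; apply/derivable1_diffP.
  by have [] := dF x x0.
split.
- move=> x; rewrite in_itv/= => /andP[ex _].
  by have [] := dF x (lt_trans e0 ex).
- by apply: cvg_at_right_filter; exact: cF.
- by apply: cvg_at_left_filter; apply: cF; exact: lt_trans eN.
Qed.

Lemma within_continuous_itv (f : R -> R) (e N : R) : 0 < e ->
  (forall x : R, 0 < x -> {for x, continuous f}) -> {within `[e, N], continuous f}.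
Proof.
move=> e0 cf; apply: continuous_in_subspaceT => x.
by rewrite inE/= in_itv/= => /andP[ex _]; apply: cf; exact: lt_le_trans ex.
Qed.

(** Exhaustion of the half-line by compact intervals
    on which continuous integrands can be handled by calculus. *)
Lemma ge0_integral_halfline_le (f : R -> \bar R) (M : \bar R) :
  measurable_fun setT f -> (forall x, 0 <= f x)%E ->
  (forall e N : R, 0 < e -> e < N -> (\int[leb]_(x in `[e, N]) f x <= M)%E) ->
  (\int[leb]_(x in `]0%R, +oo[) f x <= M)%E.
Proof.
move=> mf f0 fM.
pose F (i : nat) : set R := `[i.+1%:R^-1, i.+2%:R]%classic.
have -> : `]0%R, +oo[%classic = \bigcup_i F i :> set R.
  apply/seteqP; split => x.
    rewrite /= in_itv/= andbT => x0.
    pose i := maxn (Num.truncn x) (Num.truncn x^-1); exists i => //.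
    rewrite /F /= in_itv/=; apply/andP; split.
      rewrite -[leRHS]invrK lef_pV2 ?posrE ?invr_gt0//.
      rewrite ltW// (lt_le_trans (truncnS_gt _))// ler_nat ltnS.
      exact: leq_maxr.
    rewrite ltW// (lt_le_trans (truncnS_gt _))// ler_nat ltnS.
    by rewrite ltnW// ltnS leq_maxl.
  move=> [i _]; rewrite /F/= !in_itv/= andbT => /andP[ix _].
  by apply: lt_le_trans ix; rewrite invr_gt0.
have ndF : nondecreasing_seq F.
  move=> m n mn; rewrite subsetEset => x; rewrite /F/= !in_itv/= => /andP[h1 h2].
  apply/andP; split.
    by apply: le_trans h1; rewrite lef_pV2 ?posrE// ler_nat ltnS.
  by apply: (le_trans h2); rewrite ler_nat !ltnS.
have mF i : measurable (F i) by exact: measurable_itv.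
have mfF i : measurable_fun (F i) f by exact: measurable_funTS.
have := @ge0_nondecreasing_set_cvg_integral _ (measurableTypeR R) R F f leb
  ndF mF mfF (fun i x _ => f0 x).
move=> cvgF; rewrite -(cvg_lim _ cvgF)//; apply: lime_le.
  by apply/cvg_ex; exists (\int[leb]_(x in \bigcup_i F i) f x)%E.
apply: nearW => i; apply: fM; rewrite ?invr_gt0//.
by rewrite (@le_lt_trans _ _ 1) ?invf_le1 ?ler1n ?ltr1n.
Qed.

Lemma powR_expR_bound (y : R) : 0 <= y ->
  exists2 K, 0 <= K & forall w, 0 < w -> w `^ y * expR (- (w / 2)) <= K.
Proof.
(* ln w is compared with its tangent at c, whose slope 1 / c makes y ln w grow
   more slowly than w / 2; the summand 1 keeps c positive for y = 0. *)
move=> y0; pose c := 2 * y + 1; have c0 : 0 < c by rewrite ltr_wpDl// mulr_ge0.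
exists (expR (y * ln c)); first exact: expR_ge0.
move=> w w0; rewrite /powR gt_eqF// -expRD ler_expR.
have : ln (w / c) < w / c by rewrite ln_sublinear// divr_gt0.
rewrite ln_div ?posrE// => h.
have h1 : y * (ln w - ln c) <= y * (w / c) by rewrite ler_wpM2l// ltW.
have h2 : y * (w / c) <= w / 2.
  rewrite mulrCA ler_wpM2l ?(ltW w0)// ler_pdivrMr// /c; lra.
lra.
Qed.

(** The integrand is dominated by a multiple of the
    derivative of -1 / (1 + sqrt w), which is comparable to w^(-1/2) at the
    origin, the worst singularity allowed by 1/2 <= x, and has a finite
    integral over the half-line. *)
Lemma gamma_integral_lty (x : R) : 1 / 2 <= x ->
  (\int[leb]_(t in `]0%R, +oo[) (t `^ (x - 1) * expR (- t))%:E < +oo)%E.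
Proof.
move=> x2; have y0 : 0 <= x - 1 / 2 by rewrite subr_ge0.
have [K K0 HK] := powR_expR_bound y0.
pose h (w : R) := (2 * Num.sqrt w)^-1 * (1 + Num.sqrt w) ^- 2.
pose H (w : R) := 8 * K * - (1 + Num.sqrt w)^-1.
have s0 (w : R) : 1 + Num.sqrt w != 0 by rewrite gt_eqF// ltr_wpDr// sqrtr_ge0.
have dH (w : R) : 0 < w -> is_derive w 1 H (8 * K * h w).
  move=> w0; have ds := is_derive1_sqrt w0.
  have d1 : is_derive w 1 (fun w => 1 + Num.sqrt w) (0 + (2 * Num.sqrt w)^-1).
    exact: is_deriveD.
  have d2 := @is_deriveV R (fun w => 1 + Num.sqrt w) w _ 1 (s0 w) d1.
  have d3 := is_deriveZ (8 * K) (is_deriveN d2).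
  apply: (is_derive_eq d3); rewrite /h add0r !scaleNr opprK /GRing.scale/=.
  by rewrite (mulrC (_ ^- 2)).
have ch (w : R) : 0 < w -> {for w, continuous (fun w => 8 * K * h w)}.
  move=> w0; apply: cvgM; first exact: cvg_cst.
  apply: cvgM.
    apply: cvgV; first by rewrite mulf_neq0// gt_eqF// sqrtr_gt0.
    by apply: cvgM; [exact: cvg_cst|exact: sqrt_continuous].
  apply: cvgV; first by rewrite expf_neq0.
  apply: (cvg_comp (fun w => 1 + Num.sqrt w) (fun y => y ^+ 2)).
    by apply: cvgD; [exact: cvg_cst|exact: sqrt_continuous].
  exact: exprn_continuous.
apply: (@le_lt_trans _ _ (8 * K)%:E); last exact: ltry.
apply: ge0_integral_halfline_le.
- apply/measurable_EFinP; apply: measurable_funM; first exact: measurable_powR.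
  by apply: (@measurableT_comp _ _ _ _ _ _ expR) => //; exact: measurable_funN.
- by move=> w; rewrite lee_fin mulr_ge0 ?powR_ge0 ?expR_ge0.
move=> e N e0 eN.
apply: (@le_trans _ _ (\int[leb]_(w in `[e, N]) (8 * K * h w)%:E)%E).
  apply: ge0_integral_mono => w; first by rewrite lee_fin mulr_ge0 ?powR_ge0 ?expR_ge0.
  rewrite /= in_itv/= => /andP[ew _]; have w0 : 0 < w by exact: lt_le_trans ew.
  rewrite lee_fin.
  suff : (w : R) `^ (x - 1) * expR (- (w : R)) <= 8 * K * h w by [].
  have sw0 : 0 < Num.sqrt w by rewrite sqrtr_gt0.
  have -> : w `^ (x - 1) = w `^ (x - 1 / 2) / Num.sqrt w.
    rewrite -powR12_sqrt ?ltW// -powRB ?(gt_eqF w0) ?implybT//.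
    by congr (_ `^ _); lra.
  have -> : expR (- w) = expR (- (w / 2)) * expR (- (w / 2)).
    by rewrite -expRD; congr expR; lra.
  have Hw := HK _ w0.
  (* (1 + sqrt w)^2 <= 2 (1 + w) <= 4 e^(w / 2); with the factor 2 of h this
     is where the 8 comes from. *)
  have Ew : expR (- (w / 2)) <= 4 * (1 + Num.sqrt w) ^- 2.
    rewrite ler_pdivlMr; last by rewrite exprn_gt0// addr_gt0.
    rewrite expRN mulrC ler_pdivrMr ?expR_gt0//.
    have e1 := expR_ge1Dx (w / 2).
    have ww : Num.sqrt w ^+ 2 = w by rewrite sqr_sqrtr// ltW.
    have w2 := sqr_ge0 (1 - Num.sqrt w).
    have -> : (1 + Num.sqrt w) ^+ 2 = 2 + 2 * w - (1 - Num.sqrt w) ^+ 2.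
      by rewrite -[in 2 * w]ww; ring.
    lra.
  rewrite (_ : 8 * K * h w = K * (4 * (1 + Num.sqrt w) ^- 2) * (Num.sqrt w)^-1); last first.
    by rewrite /h; field; rewrite s0 gt_eqF.
  rewrite [leLHS](_ : _ = w `^ (x - 1 / 2) * expR (- (w / 2)) * expR (- (w / 2)) *
    (Num.sqrt w)^-1); last by ring.
  rewrite ler_wpM2r ?invr_ge0 ?(ltW sw0)// ler_pM ?expR_ge0//.
  by rewrite mulr_ge0 ?powR_ge0 ?expR_ge0.
rewrite (continuous_FTC2 (F := H) eN)//.
- rewrite -EFinB lee_fin /H -mulrBr ler_piMr ?mulr_ge0//.
  have H1 : (1 + Num.sqrt e)^-1 <= 1 by rewrite invf_le1 ?lerDl ?sqrtr_ge0// ltr_wpDr ?sqrtr_ge0.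
  have H2 : 0 <= (1 + Num.sqrt N)^-1 by rewrite invr_ge0 addr_ge0 ?sqrtr_ge0.
  lra.
- exact: within_continuous_itv.
- exact: derivable_LRcontinuous.
- move=> w; rewrite in_itv/= => /andP[ew _]; rewrite derive1E.
  by have [_ ->] := dH w (lt_trans e0 ew).
Qed.

End half_line.

Section heat_time.
Variable R : realType.
Local Notation leb := (@lebesgue_measure R).

(** Substitution w = k / v. *)
Lemma integral_inverse_subst (k e N : R) (g : R -> R) : 0 < k -> 0 < e -> e < N ->
  (forall w : R, 0 < w -> {for w, continuous g}) ->
  (\int[leb]_(v in `[e, N]) (g (k / v) * (k / v ^+ 2))%:E =
   \int[leb]_(w in `[(k / N)%R, (k / e)%R]) (g w)%:E)%E.
Proof.
move=> k0 e0 eN cg; have N0 : 0 < N by exact: lt_trans eN.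
pose F (v : R) := k * v^-1.
have dF (v : R) : 0 < v -> is_derive v 1 F (- (k / v ^+ 2)).
  move=> v0; have v0' : v != 0 by rewrite gt_eqF.
  have d1 := is_deriveZ k (@is_deriveV R id v _ 1 v0' (is_derive_id v 1)).
  by apply: (is_derive_eq d1); rewrite /GRing.scale/= mulr1 mulrN.
have F'E (v : R) : 0 < v -> (derive1 F) v = - (k / v ^+ 2).
  by move=> v0; rewrite derive1E; have [_ ->] := dF v v0.
have cF' (v : R) : 0 < v -> {for v, continuous (derive1 F)}.
  move=> v0; rewrite /prop_for /continuous_at F'E//.
  have cf : - (k / x ^+ 2) @[x --> v] --> - (k / v ^+ 2).
    apply: cvgN; apply: cvgM; first exact: cvg_cst.
    by apply: cvgV; [rewrite expf_neq0// gt_eqF|exact: exprn_continuous].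
  apply: cvg_trans cf; apply: near_eq_cvg; near=> x; rewrite F'E//.
    by near: x; exact: lt_nbhsr.
have Fe : F e = k / e by [].
have FN : F N = k / N by [].
rewrite -Fe -FN (@integration_by_substitution_decreasing R F g e N)//.
- apply: eq_integral => v; rewrite inE/= in_itv/= => /andP[ev _].
  transitivity (g (F v) * - derive1 F v)%:E; last by [].
  by rewrite F'E ?opprK//; exact: lt_le_trans ev.
- exact: ltW.
- move=> x y; rewrite !in_itv/= => /andP[ex _] /andP[ey _] yx.
  have y0 : 0 < y by exact: lt_le_trans ey.
  have x0 : 0 < x by exact: lt_le_trans ex.
  by rewrite /F ltr_pM2l// ltf_pV2 ?posrE.
- by move=> x; rewrite in_itv/= => /andP[ex _]; apply: cF'; exact: lt_trans ex.
- by apply/cvg_ex; exists ((derive1 F) e); apply: cvg_at_right_filter; exact: cF'.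
- by apply/cvg_ex; exists ((derive1 F) N); apply: cvg_at_left_filter; exact: cF'.
- exact: derivable_LRcontinuous dF.
- by apply: within_continuous_itv => //; rewrite /F mulr_gt0// invr_gt0.
Unshelve. all: by end_near. Qed.

End heat_time.

Section time.
Variables (R : realType) (d : nat).
Local Notation X := (d.-tuple R).
Local Notation leb := (@lebesgue_measure R).
Hypothesis d3 : (3 <= d)%N.

Let D2 : 1 / 2 <= d%:R / 2 - 1 :> R.
Proof.
have : 3%:R <= d%:R :> R by rewrite ler_nat.
lra.
Qed.

(** In dimension at least 3 the argument d/2 - 1 is at least
    1/2, so the integral that defines Gamma is finite. *)
Lemma gamma_integralE :
  (\int[leb]_(t in `]0%R, +oo[) (t `^ (d%:R / 2 - 1 - 1) * expR (- t))%:E =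
   (Gamma (d%:R / 2 - 1 : R))%:E)%E.
Proof.
rewrite /Gamma fineK// ge0_fin_numE ?gamma_integral_lty//.
by apply: integral_ge0 => t _; rewrite lee_fin mulr_ge0 ?powR_ge0 ?expR_ge0.
Qed.

Lemma Gamma_ge0 (x : R) : 0 <= Gamma x.
Proof.
apply: fine_ge0; apply: integral_ge0 => t _.
by rewrite lee_fin mulr_ge0 ?powR_ge0 ?expR_ge0.
Qed.

Lemma c0_ge0 : 0 <= c0 d :> R.
Proof. by rewrite /c0 divr_ge0// mulr_ge0 ?Gamma_ge0 ?powR_ge0. Qed.

(** With rho = |z - x| and k = c rho^2 / 4, the
    substitution w = k / v turns the integrand into a multiple of
    w^(d/2 - 2) e^(-w).  The point z = x is excluded since the left side is
    infinite there while 0 ^- (d - 2) is 0. *)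
Lemma integral_gauss_time (c : R) (x z : X) : 0 < c -> z != x ->
  (\int[leb]_(v in `]0%R, +oo[) gauss c 0%R x v z <=
   (c * c0 d * edist z x ^- (d - 2))%:E)%E.
Proof.
move=> c0_ zx; set rho := edist z x.
have rho0 : 0 < rho.
  rewrite lt_neqAle edist_nneg andbT eq_sym; apply: contraNneq zx => /edist_eq0 ->.
  by [].
pose k := c * rho ^+ 2 / 4; have k0 : 0 < k by rewrite divr_gt0// mulr_gt0// exprn_gt0.
pose A := (pi * rho ^+ 2) `^ (- (d%:R / 2)) * k.
have A0 : 0 <= A by rewrite mulr_ge0 ?powR_ge0// ltW.
pose g (w : R) := w `^ (d%:R / 2 - 1 - 1) * expR (- w).
have g0 w : 0 <= g w by rewrite mulr_ge0 ?powR_ge0 ?expR_ge0.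
have mg : measurable_fun setT g.
  apply: measurable_funM; first exact: measurable_powR.
  by apply: (@measurableT_comp _ _ _ _ _ _ expR) => //; exact: measurable_funN.
have -> : c * c0 d * rho ^- (d - 2) = A * Gamma (d%:R / 2 - 1).
  have rd : (rho ^+ 2) `^ (- (d%:R / 2)) = (rho ^+ (d - 2) * rho ^+ 2)^-1.
    rewrite -exprD subnK; last exact: ltnW.
    rewrite powRN -powR_mulrn ?(ltW rho0)// -powRrM mulrCA divff// mulr1.
    by rewrite powR_mulrn// ltW.
  rewrite /A /k /c0 powRM ?pi_ge0 ?sqr_ge0// rd; field.
  by rewrite !expf_neq0// gt_eqF.
rewrite EFinM -gamma_integralE -ge0_integralZl//; last 2 first.
- by apply/measurable_EFinP; exact: measurable_funTS.
- by move=> t _; rewrite lee_fin g0.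
apply: ge0_integral_halfline_le.
- apply: (@measurable_kernel_comp _ _ (@gauss R d c) _ _ (fun=> 0) (fun=> x) id (fun=> z)) => //.
  exact: measurable_gauss.
- by move=> v; exact: gauss_ge0.
move=> e N e0 eN.
apply: (@le_trans _ _ (\int[leb]_(w in `[(k / N)%R, (k / e)%R]) (A * g w)%:E)%E); last first.
  apply: ge0_subset_integral => //.
  - by apply/measurable_EFinP; apply: measurable_funTS; exact: measurable_funM.
  - by move=> w _; rewrite lee_fin mulr_ge0.
  - move=> w; rewrite /= !in_itv/= andbT => /andP[kw _]; apply: lt_le_trans kw.
    by rewrite divr_gt0// (lt_trans e0).
rewrite -integral_inverse_subst//; last first.
  move=> w w0; apply: cvgM; first exact: cvg_cst.
  apply: cvgM.
    have : {for w, continuous (@powR R ^~ (d%:R / 2 - 1 - 1))}.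
      apply: differentiable_continuous; apply/derivable1_diffP.
      by apply: derivable_powR; rewrite in_itv/= w0.
    exact.
  apply: (cvg_comp (fun w => - w) expR); last exact: continuous_expR.
  by apply: cvgN; exact: cvg_id.
rewrite le_eqVlt; apply/orP; left; apply/eqP; apply: eq_integral => v.
rewrite inE/= in_itv/= => /andP[ev _]; have v0 : 0 < v by exact: lt_le_trans ev.
rewrite /gauss v0 subr0; congr EFin.
suff : (4 * pi * (v : R) / c) `^ (- (d%:R / 2)) *
    expR (- (rho ^+ 2 / (4 * (v : R) / c))) = A * g (k / v) * (k / v ^+ 2) by [].
have v0' : (v : R) != 0 by rewrite gt_eqF.
have P0 : 0 < k / v by rewrite divr_gt0.
have -> : rho ^+ 2 / (4 * (v : R) / c) = k / v.
  by rewrite /k; field; rewrite v0' gt_eqF.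
rewrite /A /g (_ : pi * rho ^+ 2 = 4 * pi * v / c * (k / v)); last first.
  by rewrite /k; field; rewrite v0' gt_eqF.
have y0 : 0 <= 4 * pi * (v : R) / c by rewrite divr_ge0 ?mulr_ge0 ?pi_ge0 ?ltW.
rewrite (powRM _ y0 (ltW P0)).
have PP : (k / v) `^ (- (d%:R / 2)) * (k / v) `^ (d%:R / 2 - 1 - 1) = (k / v) ^- 2.
  rewrite -powRD ?(gt_eqF P0) ?implybT// -powR_invn ?(ltW P0)//.
  by congr (_ `^ _); ring.
set y := _ `^ _.
transitivity (y * ((k / v) `^ (- (d%:R / 2)) * (k / v) `^ (d%:R / 2 - 1 - 1)) *
    k * expR (- (k / v)) * (k / v ^+ 2)); last by ring.
by rewrite PP; field; rewrite v0' gt_eqF.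
Qed.
End time.

(** * Gaussian potentials of functions of Kato type *)

Section time_change.
Variable R : realType.
Local Notation leb := (@lebesgue_measure R).
Local Open Scope ereal_scope.

Lemma ge0_integral_opp (f : R -> \bar R) :
  measurable_fun setT f -> (forall x, 0 <= f x) ->
  \int[leb]_x f x = \int[leb]_x f (- x)%R.
Proof.
move=> mf f0.
have mN : measurable_fun setT (-%R : measurableTypeR R -> measurableTypeR R).
  exact: oppr_measurable.
have := @ge0_integral_pushforward _ _ (measurableTypeR R) (measurableTypeR R) R
  _ mN leb setT f measurableT mf (fun x _ => f0 x).
rewrite preimage_setT => <-.
by apply: eq_measure_integral => A mA _; exact/esym/lebesgue_measureN.
Qed.

Lemma ge0_integral_shift (s t : R) (f : R -> \bar R) :
  measurable_fun setT f -> (forall x, 0 <= f x) ->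
  \int[leb]_(u in `]s, t[) f (u - s)%R = \int[leb]_(v in `]0%R, (t - s)%R[) f v.
Proof.
move=> mf f0; rewrite integral_mkcond [RHS]integral_mkcond.
rewrite [RHS](ge0_integral_affine ltr01 (- s)%R); last 2 first.
- by apply/(measurable_restrictT _ _).1 => //; exact: measurable_funTS.
- by move=> x; rewrite /patch; case: ifP.
rewrite mul1e; apply: eq_integral => u _; rewrite /patch mul1r.
congr (if _ then _ else _); apply/idP/idP; rewrite !inE/= !in_itv/= => /andP[h1 h2];
  apply/andP; split; lra.
Qed.

Lemma ge0_integral_reflect (s t : R) (f : R -> \bar R) :
  measurable_fun setT f -> (forall x, 0 <= f x) ->
  \int[leb]_(u in `]s, t[) f (t - u)%R = \int[leb]_(v in `]0%R, (t - s)%R[) f v.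
Proof.
move=> mf f0; rewrite integral_mkcond [RHS]integral_mkcond.
have mg : measurable_fun setT (f \_ `]0%R, (t - s)%R[).
  by apply/(measurable_restrictT _ _).1 => //; exact: measurable_funTS.
have g0 x : 0 <= (f \_ `]0%R, (t - s)%R[) x by rewrite /patch; case: ifP.
rewrite [RHS]ge0_integral_opp//.
rewrite [RHS](ge0_integral_affine ltr01 (- t)%R); last 2 first.
- by apply: measurableT_comp => //; exact: oppr_measurable.
- by move=> x; exact: g0.
rewrite mul1e; apply: eq_integral => u _; rewrite /patch mul1r opprD opprK addrC.
congr (if _ then _ else _); apply/idP/idP; rewrite !inE/= !in_itv/= => /andP[h1 h2];
  apply/andP; split; lra.
Qed.
End time_change.

Section kato.
Variables (R : realType) (d : nat).
Local Notation X := (d.-tuple R).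
Local Notation leb := (@lebesgue_measure R).
Local Notation lebd := (lebesgue_tuple R d).
Hypothesis d3 : (3 <= d)%N.

Let half_gt0 : 0 < 1 / 2 :> R.
Proof. by rewrite divr_gt0. Qed.

Lemma edist_scale (k : R) (u v x z : X) : 0 <= k ->
  (forall i, tnth u i - tnth v i = k * (tnth z i - tnth x i)) ->
  edist u v = k * edist z x.
Proof.
move=> k0 E; rewrite /Defs.edist -[in RHS](ger0_norm k0) -sqrtr_sqr -sqrtrM ?sqr_ge0//.
congr Num.sqrt; rewrite mulr_sumr; apply: eq_bigr => i _.
by rewrite E -exprMn.
Qed.

Lemma gauss_decreasing (c v : R) (x z w : X) : 0 < c -> 0 < v ->
  edist w x <= edist z x -> (gauss c 0%R x v z <= gauss c 0%R x v w)%E.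
Proof.
move=> c0 v0 wz; rewrite /gauss v0 lee_fin ler_wpM2l ?powR_ge0// ler_expR lerN2.
rewrite ler_wpM2r//; last by rewrite ler_pXn2r ?nnegrE ?edist_nneg.
by rewrite invr_ge0 divr_ge0 ?mulr_ge0 ?subr_ge0 ?ltW.
Qed.

Local Open Scope ereal_scope.

Lemma lebesgue_set1 (x : X) : lebd [set x] = 0.
Proof.
have -> : [set x] = [set t : X | forall i, [set tnth x i] (tnth t i)].
  apply/seteqP; split=> [t ->//|t /= h]; apply: eq_from_tnth => i; exact: h.
rewrite (lebesgue_tuple_box (A := fun i => [set tnth x i]))//.
have dgt0 : (0 < d)%N by exact: leq_trans d3.
by rewrite (bigD1 (Ordinal dgt0))//= lebesgue_measure_set1 mul0e.
Qed.

Lemma measurable_set1_tuple (x : X) : measurable [set x].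
Proof.
have -> : [set x] = \bigcap_(i in [set: 'I_d])
    ((@tnth _ _ ^~ i) @^-1` [set tnth x i]).
  apply/seteqP; split=> [t -> //|t h]; apply: eq_from_tnth => i; exact: h.
apply: fin_bigcap_measurable => // i _.
by rewrite -[X in measurable X]setTI; exact: measurable_tnth.
Qed.

(** Points are null sets, so that the singularity at [x],
    where the inverse power takes the value 0, may be ignored. *)
Lemma ge0_integral_setC1 (x : X) (f : X -> \bar R) :
  measurable_fun setT f -> (forall z, 0 <= f z) ->
  \int[lebd]_z f z = \int[lebd]_z (if z == x then 0 else f z).
Proof.
move=> mf f0; rewrite (ge0_negligible_integral (measurable_set1_tuple x) _ mf)//; last first.
  exact: lebesgue_set1.
rewrite integral_mkcond; apply: eq_integral => z _; rewrite /patch.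
case: eqP => [->|zx].
  by rewrite ifF//; apply/negP; rewrite inE => -[_]; apply.
by rewrite ifT// inE.
Qed.

Variable (delta : R) (q : X -> \bar R) (I : R).
Hypothesis delta0 : (0 < delta)%R.
Hypothesis q0 : forall z, 0 <= q z.
Hypothesis mq : measurable_fun setT q.
Hypothesis kI : kato delta q = I%:E.

Lemma kato_ub (x : X) :
  \int[lebd]_z (if (edist z x < delta)%R then q z * (edist z x ^- (d - 2))%:E else 0)
  <= I%:E.
Proof.
rewrite -kI; apply: ereal_sup_ubound; exists x => //.
rewrite integral_mkcond; apply: eq_integral => z _; rewrite /patch gee0_abs//.
by congr (if _ then _ else _); apply/idP/idP; rewrite inE.
Qed.

Lemma measurable_fun_edist_lt (x : X) (r : R) :
  measurable_fun setT (fun z : X => (edist z x < r)%R).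
Proof. by apply: measurable_fun_ltr => //; exact: measurable_edist. Qed.

Lemma measurable_edist_pow (x : X) :
  measurable_fun setT (fun z : X => (edist z x ^- (d - 2))%:E).
Proof.
apply/measurable_EFinP.
rewrite (_ : (fun _ => _) = fun z => (edist z x `^ (- (d - 2)%:R))%R); last first.
  by apply/funext => z; rewrite powR_invn ?edist_nneg.
apply: (@measurableT_comp _ _ _ _ _ _ (fun y : R => y `^ (- (d - 2)%:R))%R) => //.
exact: measurable_edist.
Qed.

(** On the ball of radius delta the Newtonian weight
    |z - x|^(2-d) is at least delta^(2-d). *)
Lemma kato_mass (x : X) :
  \int[lebd]_z (if (edist z x < delta)%R then q z else 0) <=
  (delta ^+ (d - 2) * I)%:E.
Proof.
have mw : measurable_fun setT (fun z => (edist z x ^- (d - 2))%:E).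
  exact: measurable_edist_pow.
rewrite (ge0_integral_setC1 x); last 2 first.
- by apply: measurable_fun_ifT => //; exact: measurable_fun_edist_lt.
- by move=> z; case: ifP.
rewrite EFinM; apply: (@le_trans _ _ ((delta ^+ (d - 2))%:E *
  \int[lebd]_z (if (edist z x < delta)%R then q z * (edist z x ^- (d - 2))%:E else 0))).
  rewrite -[leRHS]ge0_integralZl//; last 3 first.
  - apply: measurable_fun_ifT => //; first exact: measurable_fun_edist_lt.
    exact: emeasurable_funM.
  - move=> z _; case: ifP => // _; rewrite mule_ge0// lee_fin invr_ge0.
    by rewrite exprn_ge0 ?edist_nneg.
  - by rewrite lee_fin exprn_ge0// ltW.
  apply: ge0_integral_mono => z _.
    by case: ifP => // _; case: ifP.
  case: eqP => [_|/eqP zx].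
    case: ifP => _; last by rewrite mule0.
    rewrite !mule_ge0// ?lee_fin ?invr_ge0 exprn_ge0 ?edist_nneg//.
    exact: ltW.
  case: ifP => [zd|_]; last by rewrite mule0.
  have e0 : (0 < edist z x)%R.
    rewrite lt_neqAle edist_nneg andbT eq_sym.
    by apply: contraNneq zx => /edist_eq0 ->.
  rewrite muleCA -[leLHS]mule1 lee_wpmul2l// -EFinM lee_fin.
  by rewrite ler_pdivlMr ?exprn_gt0// mul1r lerXn2r ?nnegrE ?edist_nneg ?ltW.
by rewrite lee_wpmul2l ?kato_ub// lee_fin exprn_ge0// ltW.
Qed.

(** Let z' be the point at distance delta / 2 from z on the
    segment from z to x.  Every point of the ball B(z', delta / 2) is at most as
    far from x as z is and has distance less than delta from z.  The Gaussian is
    radially decreasing, so on this ball it is at least its value at z. *)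
Lemma gauss_ball_average (c v : R) (x z : X) : (0 < c)%R -> (0 < v)%R ->
  (delta <= edist z x)%R ->
  gauss c 0%R x v z * (delta ^+ d * ball_volume d (1 / 2))%:E <=
  \int[lebd]_w (if (edist w z < delta)%R then gauss c 0%R x v w else 0).
Proof.
move=> c0 v0 dz; set rho := edist z x in dz.
have rho0 : (0 < rho)%R by exact: lt_le_trans dz.
(* th is the fraction of the segment from z to x that has length delta / 2. *)
pose th := (delta / (2 * rho))%R.
have th0 : (0 <= th)%R by rewrite divr_ge0 ?mulr_ge0// ltW.
have thr : (th * rho = delta * (1 / 2))%R.
  by rewrite /th; field; rewrite gt_eqF.
have th1 : (0 <= 1 - th)%R.
  rewrite subr_ge0 /th ler_pdivrMr ?mulr_gt0// mul1r; lra.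
pose z' : X := [tuple tnth x i + (1 - th) * (tnth z i - tnth x i) | i < d]%R.
have z'x : edist z' x = (rho - delta * (1 / 2))%R.
  rewrite (@edist_scale (1 - th) z' x x z)//.
    by rewrite -thr mulrBl mul1r.
  by move=> i; rewrite tnth_mktuple; ring.
have zz' : edist z' z = (delta * (1 / 2))%R.
  rewrite edistC (@edist_scale th z z' x z)//.
  by move=> i; rewrite tnth_mktuple; ring.
have r0 : (0 < delta * (1 / 2))%R by rewrite mulr_gt0.
have [_ vol] := @ball_volumeE R d (1 / 2)%R half_gt0.
rewrite EFinM -vol -(lebesgue_ball z' (1 / 2)%R delta0).
rewrite -(integral_cst lebd (measurable_edist_ball z' (delta * (1 / 2)))) ?gauss_ge0//.
rewrite integral_mkcond; apply: ge0_integral_mono => w _.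
  by rewrite /patch; case: ifP => // _; exact: gauss_ge0.
rewrite /patch; case: ifPn => [|_]; last by case: ifP => // _; exact: gauss_ge0.
rewrite inE/= => wz'.
have -> : (edist w z < delta)%R.
  have := @edist_triangle_lt R d w z' z _ _ r0 wz'; rewrite zz' => /(_ (lexx _)).
  move=> h; apply: (lt_le_trans h); lra.
apply: gauss_decreasing => //; apply: ltW.
have m0 : (0 < rho - delta * (1 / 2))%R by lra.
have := @edist_triangle_lt R d w z' x _ _ m0 wz'; rewrite z'x => /(_ (lexx _)).
by rewrite addrC subrK.
Qed.

Lemma measurable_gauss_snd (c v : R) (x : X) : (0 < c)%R ->
  measurable_fun setT (fun z => gauss c 0%R x v z).
Proof.
move=> c0; apply: (@measurable_kernel_comp _ _ (@gauss R d c) _ _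
  (fun=> 0%R) (fun=> x) (fun=> v) id) => //; exact: measurable_gauss.
Qed.

(** After replacing the Gaussian at z by its average over points
    w with |w - z| < delta, Tonelli's theorem leaves the mass of q in the balls
    B(w, delta), integrated against a probability density. *)
Lemma potential_far (c v : R) (x : X) : (0 < c)%R -> (0 < v)%R ->
  \int[lebd]_z (if (delta <= edist z x)%R then gauss c 0%R x v z * q z else 0)
  <= (I / (ball_volume d (1 / 2) * delta ^+ 2))%:E.
Proof.
move=> c0 v0; have [beta0 _] := @ball_volumeE R d (1 / 2)%R half_gt0.
set beta := ball_volume _ _ in beta0 *.
have dd0 : (0 < delta ^+ d * beta)%R by rewrite mulr_gt0// exprn_gt0.
have mg := measurable_gauss_snd v x c0.
have mfar : measurable_fun setT (fun z => if (delta <= edist z x)%R then gauss c 0%R x v z * q z else 0).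
  apply: measurable_fun_ifT => //.
    by apply: measurable_fun_ler => //; exact: measurable_edist.
  exact: emeasurable_funM.
have far0 z : 0 <= (if (delta <= edist z x)%R then gauss c 0%R x v z * q z else 0).
  by case: ifP => // _; rewrite mule_ge0// gauss_ge0.
pose f w z : \bar R := if (edist w z < delta)%R then gauss c 0%R x v w * q z else 0.
have f0 w z : 0 <= f w z by rewrite /f; case: ifP => // _; rewrite mule_ge0// gauss_ge0.
have mf : measurable_fun setT (fun w : X * X => f w.1 w.2).
  apply: measurable_fun_ifT => //.
    by apply: measurable_fun_ltr => //; exact: measurable_edist.
  apply: emeasurable_funM; first exact: (measurableT_comp mg).
  exact: (measurableT_comp mq).
suff : \int[lebd]_z (if (delta <= edist z x)%R then gauss c 0%R x v z * q z else 0) *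
    (delta ^+ d * beta)%:E <= (delta ^+ (d - 2) * I)%:E.
  rewrite -lee_pdivlMr// -EFinM => h; apply: (le_trans h); rewrite lee_fin.
  rewrite le_eqVlt; apply/orP; left; apply/eqP.
  have -> : (delta ^+ d = delta ^+ (d - 2) * delta ^+ 2)%R.
    by rewrite -exprD subnK// ltnW.
  by field; rewrite gt_eqF// expf_neq0 ?gt_eqF.
rewrite -ge0_integralZr//; last by rewrite lee_fin ltW.
apply: (@le_trans _ _ (\int[lebd]_z \int[lebd]_w f w z)).
  apply: ge0_integral_mono => z _.
    by rewrite mule_ge0// lee_fin ltW.
  case: ifP => [dz|_]; last by rewrite mul0e; exact: integral_ge0.
  rewrite muleAC; apply: le_trans (lee_wpmul2r (q0 z) (gauss_ball_average c0 v0 dz)) _.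
  rewrite -ge0_integralZr//; last 2 first.
  - apply: measurable_fun_ifT => //; exact: measurable_fun_edist_lt.
  - by move=> w _; case: ifP => // _; exact: gauss_ge0.
  by apply: ge0_integral_mono => w _; rewrite /f; case: ifP; rewrite ?mul0e// => _;
    rewrite mule_ge0// gauss_ge0.
rewrite -(tonelli_in lebd lebd (f := f))//.
apply: (@le_trans _ _ (\int[lebd]_w (gauss c 0%R x v w * (delta ^+ (d - 2) * I)%:E))).
  apply: ge0_integral_mono => w _; first exact: integral_ge0.
  apply: le_trans (lee_wpmul2l (gauss_ge0 _ _ _ _ _) (kato_mass w)).
  rewrite -ge0_integralZl//; last 3 first.
  - by apply: measurable_fun_ifT => //; exact: measurable_fun_edist_lt.
  - by move=> z _; case: ifP.
  - exact: gauss_ge0.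
  apply: ge0_integral_mono => z _ //; rewrite /f edistC.
  by case: ifP; rewrite ?mule0.
have I0 : (0 <= I)%R.
  by rewrite -lee_fin; apply: le_trans (kato_ub x); apply: integral_ge0 => z _;
    case: ifP => // _; rewrite mule_ge0// lee_fin invr_ge0 exprn_ge0 ?edist_nneg.
rewrite ge0_integralZr//; last 2 first.
- by move=> w _; exact: gauss_ge0.
- by rewrite lee_fin mulr_ge0// exprn_ge0// ltW.
by rewrite integral_gauss// mul1e.
Qed.

Lemma measurable_gauss_pair (c : R) (x : X) : (0 < c)%R ->
  measurable_fun setT (fun w : R * X => gauss c 0%R x w.1 w.2).
Proof.
move=> c0; apply: (@measurable_kernel_comp _ _ (@gauss R d c) _ _
  (fun=> 0%R) (fun=> x) fst snd) => //; exact: measurable_gauss.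
Qed.

Definition near_potential (c : R) (x : X) (v : R) (z : X) : \bar R :=
  if (0 < edist z x < delta)%R then gauss c 0%R x v z * q z else 0.

Lemma near_potential_ge0 c x v z : 0 <= near_potential c x v z.
Proof. by rewrite /near_potential; case: ifP => // _; rewrite mule_ge0// gauss_ge0. Qed.

Lemma measurable_near_potential (c : R) (x : X) : (0 < c)%R ->
  measurable_fun setT (fun w : R * X => near_potential c x w.1 w.2).
Proof.
move=> c0; apply: measurable_fun_ifT => //.
  by apply: measurable_and; apply: measurable_fun_ltr => //; exact: measurable_edist.
apply: emeasurable_funM; first exact: measurable_gauss_pair.
exact: (measurableT_comp mq).
Qed.

(** Integrating in time first gives c c0 |z - x|^(2-d), so that
    the space integral becomes the one in the definition of [kato]. *)
Lemma potential_near (c T : R) (x : X) : (0 < c)%R ->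
  \int[leb]_(v in `]0%R, T[) \int[lebd]_z near_potential c x v z
  <= (c * c0 d * I)%:E.
Proof.
move=> c0; have cc0 : (0 <= c * Defs.c0 d)%R by rewrite mulr_ge0 ?c0_ge0// ltW.
rewrite (tonelli_in leb lebd (f := near_potential c x))//; last 2 first.
- exact: measurable_near_potential.
- exact: near_potential_ge0.
have mw : measurable_fun setT (fun z => (edist z x ^- (d - 2))%:E).
  exact: measurable_edist_pow.
apply: (@le_trans _ _ (\int[lebd]_z ((c * Defs.c0 d)%:E *
    (if (edist z x < delta)%R then q z * (edist z x ^- (d - 2))%:E else 0)))).
  apply: ge0_integral_mono => z _.
    by apply: integral_ge0 => *; exact: near_potential_ge0.
  rewrite /near_potential.
  case: (boolP (0 < edist z x < delta)%R) => [/andP[z0 ->]|_]; last first.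
    rewrite integral0_eq//; case: ifP; rewrite ?mule0// => _.
    by rewrite !mule_ge0// lee_fin// invr_ge0 exprn_ge0// edist_nneg.
  have mv D : measurable_fun D (fun v => gauss c 0%R x v z).
    apply: measurable_funTS; apply: (@measurable_kernel_comp _ _ (@gauss R d c) _ _
      (fun=> 0%R) (fun=> x) id (fun=> z)) => //; exact: measurable_gauss.
  rewrite ge0_integralZr//; [|exact: mv|by move=> *; exact: gauss_ge0].
  rewrite [leRHS]muleCA muleC lee_wpmul2l//.
  rewrite -EFinM; apply: le_trans (integral_gauss_time d3 _ _) => //; last first.
    by apply: contraTneq z0 => ->; rewrite edistxx ltxx.
  apply: ge0_subset_integral => //; [exact: mv|by move=> *; exact: gauss_ge0|].
  by move=> v; rewrite /= !in_itv/= andbT => /andP[].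
rewrite ge0_integralZl//; last 2 first.
- apply: measurable_fun_ifT => //; first exact: measurable_fun_edist_lt.
  exact: emeasurable_funM.
- move=> z _; case: ifP => // _; rewrite mule_ge0// lee_fin invr_ge0.
  by rewrite exprn_ge0 ?edist_nneg.
by rewrite (EFinM (c * Defs.c0 d)%R) lee_wpmul2l// ?lee_fin// kato_ub.
Qed.

Lemma potential_le (c T : R) (x : X) : (0 < c)%R -> (0 < T)%R ->
  \int[leb]_(v in `]0%R, T[) \int[lebd]_z (gauss c 0%R x v z * q z)
  <= (c * c0 d * I + T * (I / (ball_volume d (1 / 2) * delta ^+ 2)))%:E.
Proof.
move=> c0 T0; set K := (I / _)%R.
have K0 : (0 <= K)%R.
  by rewrite -lee_fin; apply: le_trans (potential_far x c0 ltr01);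
    apply: integral_ge0 => z _; case: ifP => // _; rewrite mule_ge0// gauss_ge0.
have mnear := measurable_near_potential x c0.
apply: (@le_trans _ _ (\int[leb]_(v in `]0%R, T[)
    (\int[lebd]_z near_potential c x v z + K%:E))).
  apply: ge0_integral_mono => v.
    by move=> _; apply: integral_ge0 => z _; rewrite mule_ge0// gauss_ge0.
  rewrite /= in_itv/= => /andP[v0 _].
  have mg := measurable_gauss_snd v x c0.
  apply: le_trans (leeD2l _ (potential_far x c0 v0)).
  rewrite -ge0_integralD//; last 4 first.
  - by move=> *; exact: near_potential_ge0.
  - exact: (measurable_fun_pair2 _ mnear).
  - by move=> z _; case: ifP => // _; rewrite mule_ge0// gauss_ge0.
  - apply: measurable_fun_ifT => //; last exact: emeasurable_funM.
    by apply: measurable_fun_ler => //; exact: measurable_edist.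
  rewrite (ge0_integral_setC1 x); last 2 first.
  - exact: emeasurable_funM.
  - by move=> z; rewrite mule_ge0// gauss_ge0.
  apply: ge0_integral_mono => z _.
    by case: ifP => // _; rewrite mule_ge0// gauss_ge0.
  rewrite /near_potential; case: eqP => [_|/eqP zx].
    by rewrite adde_ge0//; case: ifP => // _; rewrite mule_ge0// gauss_ge0.
  have -> : (0 < edist z x)%R.
    rewrite lt_neqAle edist_nneg andbT eq_sym.
    by apply: contraNneq zx => /edist_eq0 ->.
  by case: (ltP (edist z x) delta) => _; rewrite ?adde0 ?add0e.
rewrite ge0_integralD//; last 2 first.
- by move=> v _; apply: integral_ge0 => *; exact: near_potential_ge0.
- apply: measurable_funTS; apply: (@measurable_integral2 _ _ _ _ _ lebd (near_potential c x)) => //.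
  by move=> *; exact: near_potential_ge0.
rewrite EFinD; apply: leeD; first exact: potential_near.
have lT : leb `]0%R, T[%classic = T%:E.
  by rewrite lebesgue_measure_itv/= lte_fin T0 sube0.
by rewrite integral_cst// (EFinM T K) [leRHS]muleC -lT.
Qed.
End kato.

(** * Gaussian kernels and the class N *)

Section gauss_class.
Variables (R : realType) (d : nat).
Local Notation X := (d.-tuple R).
Local Notation leb := (@lebesgue_measure R).
Local Notation lebd := (lebesgue_tuple R d).

Lemma gauss_le (a b s t : R) (x y : X) : 0 < a -> a < b -> s < t ->
  (gauss b s x t y <= ((b / a) `^ (d%:R / 2))%:E * gauss a s x t y)%E.
Proof.
move=> a0 ab st; have b0 : 0 < b by exact: lt_trans ab.
have ts0 : 0 < t - s by rewrite subr_gt0.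
have pi0 := pi_gt0 R.
rewrite !gauss_expR// -EFinM lee_fin.
rewrite /powR gt_eqF ?divr_gt0// -expRD ler_expR.
have -> : ln (4 * pi * (t - s) / a) = ln (4 * pi * (t - s) / b) + ln (b / a).
  rewrite -lnM ?posrE ?divr_gt0 ?mulr_gt0 ?pi_gt0 ?invr_gt0//.
  by congr ln; field; rewrite !gt_eqF.
have key : edist y x ^+ 2 * a / (4 * (t - s)) <= edist y x ^+ 2 * b / (4 * (t - s)).
  by rewrite ler_pM2r ?invr_gt0 ?mulr_gt0// ler_wpM2l ?sqr_ge0 ?ltW.
lra.
Qed.

Lemma powR_div_ge1 (a b : R) : 0 < a -> a < b -> 1 <= (b / a) `^ (d%:R / 2).
Proof.
move=> a0 ab; rewrite -[leLHS](powRr0 (b / a)) ler_powR ?divr_ge0//.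
by rewrite ler_pdivlMr// mul1r ltW.
Qed.

Lemma M_const_ge0 (a b : R) : 0 <= M_const d a b.
Proof. by rewrite mulr_ge0 ?powR_ge0 ?expR_ge0. Qed.

Lemma regular_superadditiveZ (c : R) (Q : R -> R -> R) : 0 <= c ->
  regular_superadditive Q -> regular_superadditive (fun s t => c * Q s t).
Proof.
move=> c0 hQ; split.
- by move=> s t; rewrite mulr_ge0// (superadditive_ge0 hQ).
- by move=> s u t su ut; rewrite -mulrDr ler_wpM2l// (superadditiveD hQ).
- by move=> s t ts; rewrite (superadditive0 hQ)// mulr0.
- by move=> s t; apply: cvgM; [exact: cvg_cst|exact: (@superadditive_rcont _ _ hQ)].
- by move=> s t; apply: cvgM; [exact: cvg_cst|exact: (@superadditive_lcont _ _ hQ)].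
Qed.

(** The positive part of t - s is
    ((t - s) + |t - s|) / 2, which is continuous in both variables. *)
Lemma regular_superadditive_length :
  regular_superadditive (fun s t : R => if s < t then t - s else 0).
Proof.
have E (s t : R) : (if s < t then t - s else 0) = (t - s + `|t - s|) / 2.
  case: ltP => st; first by rewrite gtr0_norm ?subr_gt0//; lra.
  by rewrite ler0_norm ?subr_le0//; lra.
split.
- by move=> s t; case: ifP => // /ltW; rewrite subr_ge0.
- by move=> s u t su ut; rewrite su ut (lt_trans su ut) addrC addrA subrK.
- by move=> s t; rewrite leNgt => /negbTE ->.
- move=> s t; rewrite E; under eq_fun do rewrite E.
  apply: cvg_at_right_filter; apply: cvgM; last exact: cvg_cst.
  by apply: cvgD; [|apply: cvg_norm]; apply: cvgB; [exact: cvg_cst|exact: cvg_id|exact: cvg_cst|exact: cvg_id].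
- move=> s t; rewrite E; under eq_fun do rewrite E.
  apply: cvg_at_left_filter; apply: cvgM; last exact: cvg_cst.
  by apply: cvgD; [|apply: cvg_norm]; apply: cvgB; [exact: cvg_id|exact: cvg_cst|exact: cvg_id|exact: cvg_cst].
Qed.

Lemma gauss_shift (c s u : R) (x z : X) : gauss c s x u z = gauss c 0 x (u - s) z.
Proof. by rewrite /gauss subr_gt0 subr0. Qed.

Section potential.
Variables (h : R) (q : X -> \bar R) (I : R).
Hypothesis d3 : (3 <= d)%N.
Hypothesis h0 : 0 < h.
Hypothesis q0 : forall z, (0 <= q z)%E.
Hypothesis mq : measurable_fun setT q.
Hypothesis kI : kato (Num.sqrt h) q = I%:E.
Local Open Scope ereal_scope.

Let sh0 : (0 < Num.sqrt h)%R. Proof. by rewrite sqrtr_gt0. Qed.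

Let P (c : R) (x : X) (v : R) := \int[lebd]_z (gauss c 0%R x v z * q z).

Let mP c x : (0 < c)%R -> measurable_fun setT (P c x).
Proof.
move=> c0; apply: (@measurable_integral2 _ _ _ _ _ lebd
  (fun v z => gauss c 0%R x v z * q z)).
  apply: emeasurable_funM; first exact: measurable_gauss_pair.
  exact: (measurableT_comp mq).
by move=> *; rewrite mule_ge0// gauss_ge0.
Qed.

Let P0 c x v : 0 <= P c x v.
Proof. by apply: integral_ge0 => *; rewrite mule_ge0// gauss_ge0. Qed.

(** By [gauss_mul_le] the integrand is at most
    M g_a(s,x,t,y) q(z) times the sum of a Gaussian started from x and one
    ending at y.  Time translation and time reversal bring both to the form
    treated in [potential_le]. *)
Lemma gauss_class_int_le (a b s t : R) (x y : X) :
  (0 < a)%R -> (a < b)%R -> (s < t)%R ->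
  \int[leb]_(u in `]s, t[) \int[lebd]_z
    (gauss b s x u z * q z * gauss a u z t y) <=
  (b * c0 d * M_const d a b * I +
   (t - s) * I * (2 * M_const d a b / (ball_volume d (1 / 2) * h)))%:E *
  gauss a s x t y.
Proof.
move=> a0 ab st; have b0 : (0 < b)%R by exact: lt_trans ab.
have ba0 : (0 < b - a)%R by rewrite subr_gt0.
have ts0 : (0 < t - s)%R by rewrite subr_gt0.
have [G GE] : exists G : R, gauss a s x t y = G%:E by eexists.
have G0 : (0 <= G)%R by rewrite -lee_fin -GE gauss_ge0.
set M := M_const d a b; have M0 : (0 <= M)%R by exact: M_const_ge0.
have MG0 : (0 <= M * G)%R by exact: mulr_ge0.
apply: (@le_trans _ _ (\int[leb]_(u in `]s, t[)
    ((M * G)%:E * (P (b - a) x (u - s)%R + P a y (t - u)%R)))).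
  apply: ge0_integral_mono => u.
    by move=> _; apply: integral_ge0 => z _; rewrite !mule_ge0// gauss_ge0.
  rewrite /= in_itv/= => /andP[su ut].
  have m1 : measurable_fun setT (fun z => gauss (b - a) 0%R x (u - s)%R z * q z).
    by apply: emeasurable_funM => //; exact: measurable_gauss_snd.
  have m2 : measurable_fun setT (fun z => gauss a 0%R y (t - u)%R z * q z).
    by apply: emeasurable_funM => //; exact: measurable_gauss_snd.
  rewrite /P -[X in _ * X]ge0_integralD//; last 2 first.
  - by move=> *; rewrite mule_ge0// gauss_ge0.
  - by move=> *; rewrite mule_ge0// gauss_ge0.
  rewrite -[leRHS]ge0_integralZl//; last 2 first.
  - exact: emeasurable_funD.
  - by move=> *; rewrite adde_ge0// mule_ge0// gauss_ge0.
  apply: ge0_integral_mono => z _; first by rewrite !mule_ge0// gauss_ge0.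
  rewrite -gauss_shift (gaussC _ _ _ y z) (_ : gauss a 0%R z (t - u)%R y = gauss a u z t y); last first.
    by rewrite -gauss_shift.
  rewrite -ge0_muleDl ?gauss_ge0// muleAC muleA lee_wpmul2r//.
  apply: le_trans (gauss_mul_le x z y a0 ab su ut) _.
  by rewrite GE EFinM muleAC.
have mP1 : measurable_fun setT (fun u : R => P (b - a) x (u - s)%R).
  exact: (measurableT_comp (mP x ba0) (measurable_funB (@measurable_id _ _ _) (measurable_cst s))).
have mP2 : measurable_fun setT (fun u : R => P a y (t - u)%R).
  exact: (measurableT_comp (mP y a0) (measurable_funB (measurable_cst t) (@measurable_id _ _ _))).
have E1 : \int[leb]_(u in `]s, t[)
      ((M * G)%:E * (P (b - a) x (u - s)%R + P a y (t - u)%R)) =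
    (M * G)%:E * (\int[leb]_(v in `]0%R, (t - s)%R[) P (b - a) x v +
      \int[leb]_(v in `]0%R, (t - s)%R[) P a y v).
  have S1 : \int[leb]_(u in `]s, t[) P (b - a) x (u - s)%R =
      \int[leb]_(v in `]0%R, (t - s)%R[) P (b - a) x v.
    exact: (ge0_integral_shift s t (mP x ba0) (P0 (b - a) x)).
  have S2 : \int[leb]_(u in `]s, t[) P a y (t - u)%R =
      \int[leb]_(v in `]0%R, (t - s)%R[) P a y v.
    exact: (ge0_integral_reflect s t (mP y a0) (P0 a y)).
  have MG0' : 0 <= (M * G)%:E by rewrite lee_fin.
  rewrite [LHS](ge0_integralZD leb (measurable_itv `]s, t[) MG0' mP1 mP2
    (fun u => P0 _ _ _) (fun u => P0 _ _ _)).
  exact: (f_equal2 (fun v w => (M * G)%:E * (v + w)) S1 S2).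
rewrite E1.
have H1 := potential_le d3 sh0 q0 mq kI x ba0 ts0.
have H2 := potential_le d3 sh0 q0 mq kI y a0 ts0.
apply: le_trans (lee_wpmul2l _ (leeD H1 H2)) _; first by rewrite lee_fin.
have [beta0 _] : (0 < ball_volume d (1 / 2))%R /\ _ :=
  @ball_volumeE R d (1 / 2)%R (divr_gt0 ltr01 (ltr0Sn _ _)).
rewrite GE -EFinD -!EFinM lee_fin sqr_sqrtr ?(ltW h0)// le_eqVlt.
apply/orP; left; apply/eqP; rewrite -/M; field.
by rewrite !gt_eqF.
Qed.
End potential.

Lemma gauss_class (a b h : R) (q : X -> \bar R) : (3 <= d)%N ->
  0 < a -> a < b -> 0 < h -> (forall z, (0 <= q z)%E) ->
  measurable_fun setT q -> (kato (Num.sqrt h) q < +oo)%E ->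
  class_N (@gauss R d b) (@gauss R d a) ((b / a) `^ (d%:R / 2))
    (b * c0 d * M_const d a b * fine (kato (Num.sqrt h) q))
    (fun s t => if s < t
       then (t - s) * fine (kato (Num.sqrt h) q) *
         (2 * M_const d a b / (ball_volume d (1 / 2) * h))
       else 0)
    (fun _ z => q z).
Proof.
move=> d3 a0 ab h0 q0 mq kfin; have b0 : 0 < b by exact: lt_trans ab.
have k0 : (0 <= kato (Num.sqrt h) q)%E.
  apply: le_trans (ereal_sup_ubound _); last by exists [tuple of nseq d 0].
  apply: integral_ge0 => z _; rewrite mule_ge0// lee_fin.
  by rewrite invr_ge0 exprn_ge0// edist_nneg.
have kI : kato (Num.sqrt h) q = (fine (kato (Num.sqrt h) q))%:E.
  by rewrite fineK// ge0_fin_numE.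
set I := fine _ in kI *; have I0 : 0 <= I by exact: fine_ge0.
have [beta0 _] : (0 < ball_volume d (1 / 2)) /\ _ :=
  @ball_volumeE R d (1 / 2)%R (divr_gt0 ltr01 (ltr0Sn _ _)).
split => //.
- exact: gauss_transition.
- exact: gauss_transition.
- exact: powR_div_ge1.
- by rewrite mulr_ge0// mulr_ge0 ?M_const_ge0// mulr_ge0 ?c0_ge0// ltW.
- have -> : (fun s t : R => if s < t
       then (t - s) * I * (2 * M_const d a b / (ball_volume d (1 / 2) * h))
       else 0) = fun s t : R =>
      I * (2 * M_const d a b / (ball_volume d (1 / 2) * h)) *
      (if s < t then t - s else 0).
    by apply/funext => s; apply/funext => t; case: ifP => _; [ring|rewrite mulr0].
  apply: regular_superadditiveZ; last exact: regular_superadditive_length.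
  apply: mulr_ge0 => //; apply: divr_ge0; apply: mulr_ge0;
    by rewrite ?M_const_ge0 ?(ltW beta0) ?(ltW h0).
- exact: (measurableT_comp mq).
- by move=> s t x y st; exact: gauss_le.
- by move=> s t x y st; rewrite st; exact: gauss_class_int_le.
Qed.

(** The kernel r = exp(lam (t - s)) g_a still satisfies the
    Chapman-Kolmogorov equation, because the exponential is multiplicative over
    consecutive time intervals; p and r fulfil the assumptions of
    [schrodinger_le] with eta and Q multiplied by Lam. *)
Lemma schrodinger_gauss_le (p : kernel_fun R d) (b Lam lam a : R)
    (q : R -> X -> \bar R) (eta : R) (Q : R -> R -> R) :
  transition_density p -> 0 < b -> 1 <= Lam ->
  (forall s t x y, s < t ->
     (p s x t y <= (Lam * expR (lam * (t - s)))%:E * gauss b s x t y)%E) ->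
  0 < a ->
  class_N (@gauss R d b) (@gauss R d a) ((b / a) `^ (d%:R / 2)) eta Q q ->
  forall (s t : R) (x y : X) (eps : R),
    s < t -> 0 < eps -> eps < 1 - Lam * eta ->
    (schrodinger_perturbation p q s x t y <=
     ((Lam * (b / a) `^ (d%:R / 2) / (1 - Lam * eta - eps)) `^ (1 + Lam * Q s t / eps)
      * expR (lam * (t - s)))%:E * gauss a s x t y)%E.
Proof.
move=> [p0 mp pCK] b0 Lam1 hpb a0 [_ [ga0 mga gaCK] K1 eta0 hQ q0 mq gba intN].
move=> s t x y eps st eps0 eps1.
have Lam0 : 0 <= Lam by exact: le_trans Lam1.
have muleEA (u v : R) (w : \bar R) : (u%:E * (v%:E * w) = (u * v)%:E * w)%E.
  by rewrite muleA -EFinM.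
have mule4 (u v : R) (A B D : \bar R) :
    (A * B * ((u * v)%:E * D) = u%:E * A * B * (v%:E * D))%E.
  by rewrite EFinM -!muleA [RHS]muleCA; congr (_ * _)%E; rewrite [RHS]muleCA.
pose r : kernel_fun R d := fun s x t y =>
  ((expR (lam * (t - s)))%:E * gauss a s x t y)%E.
have r0 s' x' t' y' : (0 <= r s' x' t' y')%E.
  by rewrite mule_ge0// lee_fin expR_ge0.
have mr : kernel_measurable r.
  apply: emeasurable_funM => //; apply/measurable_EFinP.
  apply: (@measurableT_comp _ _ _ _ _ _ expR) => //; apply: measurable_funM => //.
  apply: measurable_funB.
    exact: (measurableT_comp (@measurable_fst _ _ R X) (@measurable_snd _ _ (R * X)%type (R * X)%type)).
  exact: (measurableT_comp (@measurable_fst _ _ R X) (@measurable_fst _ _ (R * X)%type (R * X)%type)).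
have rCK s' u' t' x' y' : s' < u' -> u' < t' ->
    (\int[lebd]_z (r s' x' u' z * r u' z t' y') = r s' x' t' y')%E.
  move=> su ut; rewrite /r -(gaCK _ _ _ _ _ su ut) -ge0_integralZl//.
  - apply: eq_integral => z _; rewrite muleACA; congr (_ * _)%E.
    by rewrite -EFinM -expRD; congr (expR _)%:E; ring.
  - apply: emeasurable_funM.
      by apply: (@measurable_kernel_comp _ _ (@gauss R d a) _ _
        (fun=> s') (fun=> x') (fun=> u') id).
    by apply: (@measurable_kernel_comp _ _ (@gauss R d a) _ _
      (fun=> u') id (fun=> t') (fun=> y')).
  - by move=> *; rewrite mule_ge0.
have C1 : 1 <= Lam * (b / a) `^ (d%:R / 2) by rewrite mulr_ege1.
have pr s' t' x' y' : s' < t' ->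
    (p s' x' t' y' <= (Lam * (b / a) `^ (d%:R / 2))%:E * r s' x' t' y')%E.
  move=> st'; apply: le_trans (hpb _ _ _ _ st') _.
  rewrite [leRHS](_ : _ = (Lam * expR (lam * (t' - s')))%:E *
      (((b / a) `^ (d%:R / 2))%:E * gauss a s' x' t' y'))%E; last first.
    by rewrite [LHS]muleEA [RHS]muleEA; congr (_ * _)%E; congr EFin; ring.
  apply: lee_wpmul2l; last exact: gba.
  by rewrite lee_fin mulr_ge0 ?expR_ge0.
have pqr s' t' x' y' : s' < t' ->
    (duhamel p q r s' x' t' y' <= (Lam * eta + Lam * Q s' t')%:E * r s' x' t' y')%E.
  move=> st'; pose c := Lam * expR (lam * (t' - s')).
  have c0 : 0 <= c by rewrite mulr_ge0// expR_ge0.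
  apply: (@le_trans _ _ (c%:E * duhamel (@gauss R d b) q (@gauss R d a) s' x' t' y')%E).
    apply: (@le_trans _ _ (duhamel (@gauss R d b) q
        (fun s x t y => c%:E * gauss a s x t y)%E s' x' t' y')); last first.
      by rewrite (@duhamelZ _ _ _ _ (gauss_ge0 b) (measurable_gauss b0) q0 mq).
    apply: ge0_integral_mono => u.
      by move=> _; apply: integral_ge0 => z _; rewrite !mule_ge0.
    rewrite /= in_itv/= => /andP[su ut]; apply: ge0_integral_mono => z _.
      by rewrite !mule_ge0.
    have -> : c = Lam * expR (lam * (u - s')) * expR (lam * (t' - u)).
      by rewrite /c -mulrA -expRD; congr (_ * expR _); ring.
    rewrite [leRHS](_ : _ = (Lam * expR (lam * (u - s')))%:E * gauss b s' x' u z *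
        q u z * r u z t' y')%E; last first.
      exact: mule4.
    by rewrite lee_wpmul2r// lee_wpmul2r//; exact: hpb.
  rewrite [leRHS](_ : _ = c%:E * ((eta + Q s' t')%:E * gauss a s' x' t' y'))%E.
    by rewrite lee_wpmul2l ?lee_fin//; exact: intN.
  by rewrite [LHS]muleEA [RHS]muleEA; congr (_ * _)%E; congr EFin; rewrite /c; ring.
have eta0' : 0 <= Lam * eta by exact: mulr_ge0.
have := schrodinger_le p0 mp q0 mq pCK r0 mr rCK C1 eta0'
  (regular_superadditiveZ Lam0 hQ) pr pqr eps0 eps1 x y st.
by rewrite /r muleEA.
Qed.
End gauss_class.

Theorem theorem1p4 (R : realType) (d : nat) (hd : (1 <= d)%N)
    (p : kernel_fun R d) (hp : transition_density p)
    (b Lam lam : R) (hb : 0 < b) (hLam : 1 <= Lam)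
    (hpb : forall s t x y, s < t ->
      (p s x t y <= (Lam * expR (lam * (t - s)))%:E * gauss b s x t y)%E)
    (a : R) (ha : 0 < a) (hab : a < b) :
  let C := Lam * (b / a) `^ (d%:R / 2) in
  (forall (q : R -> d.-tuple R -> \bar R) (eta : R) (Q : R -> R -> R),
     class_N (@gauss R d b) (@gauss R d a) ((b / a) `^ (d%:R / 2)) eta Q q ->
     forall (s t : R) (x y : d.-tuple R) (eps : R),
       s < t -> 0 < eps -> eps < 1 - Lam * eta ->
       (schrodinger_perturbation p q s x t y <=
        ((C / (1 - Lam * eta - eps)) `^ (1 + Lam * Q s t / eps)
         * expR (lam * (t - s)))%:E * gauss a s x t y)%E)
  /\
  ((3 <= d)%N ->
   forall (h : R) (q : d.-tuple R -> \bar R),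
     0 < h ->
     (forall z, (0 <= q z)%E) ->
     measurable_fun [set: d.-tuple R] q ->
     (kato (Num.sqrt h) q < +oo)%E ->
     let I := fine (kato (Num.sqrt h) q) in
     let M := M_const d a b in
     class_N (@gauss R d b) (@gauss R d a) ((b / a) `^ (d%:R / 2))
       (b * c0 d * M * I)
       (fun s t => if s < t
                   then (t - s) * I * (2 * M / (ball_volume d (1 / 2) * h))
                   else 0)
       (fun _ z => q z)).

Proof.
move=> C; split.
  move=> q eta Q hN s t x y eps.
  exact: (schrodinger_gauss_le hp hb hLam hpb ha hN).
by move=> d3 h q h0 q0 mq kfin I M; exact: gauss_class.
Qed.
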